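(* Let $\pi\in S_k$. Then the number of $\pi$-hits in each $\tau\in S_n$ can be computed in $\Theta(n!)$ time, where the implied constants do not depend on $k$.
   Context: A permutation in $S_m$ is a word containing each of $1,\dots,m$ exactly once. For $\pi\in S_k$ and $\tau\in S_n$, a $\pi$-hit in $\tau$ is a $k$-letter subsequence of $\tau$ order-isomorphic to $\pi$ (having the same relative order of letters). Model of computation: a word RAM in which each permutation of length at most $n$ (letters stored in fixed-width bit blocks) fits in a constant number of machine words, standard integer and bitwise operations, shifts and popcount take constant time, and hash tables keyed by such words support insertion and lookup in constant time. *)

(* Defs.v *)
From Stdlib Require Import BinNat.
From mathcomp Require Import all_boot all_fingroup.

Set Implicit Arguments.
Unset Strict Implicit.
Unset Printing Implicit Defensive.

(* ['S_n] permutes 0, .., n-1; the word it denotes uses the letters 1, .., n. *)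
Definition perm_word (n : nat) (s : 'S_n) : seq nat :=
  [seq (s i).+1 | i <- enum 'I_n].

Definition order_iso (u v : seq nat) : bool :=
  (size u == size v) &&
  [forall i : 'I_(size u), forall j : 'I_(size u),
     (nth 0 u i < nth 0 u j) == (nth 0 v i < nth 0 v j)].

(* A subsequence of tau is given by its set of positions; [enum A] lists the
   positions in increasing order. *)
Definition hits (k n : nat) (p : 'S_k) (t : 'S_n) : {set {set 'I_n}} :=
  [set A : {set 'I_n} |
     order_iso (perm_word p) [seq (t i).+1 | i <- enum A]].

(* For n > 0 this is the least b such that the letters 1, .., n are < 2 ^ b. *)
Definition letter_bits (n : nat) : nat := (trunc_log 2 n).+1.

(* Letter number i (from 0) occupies the bits b * i, .., b * i + b - 1. *)
Definition pack (b : nat) (s : seq nat) : N :=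
  foldr (fun a x => N.add (N.of_nat a) (N.shiftl x (N.of_nat b))) N0 s.

Definition pack_perm (n : nat) (t : 'S_n) : N :=
  pack (letter_bits n) (perm_word t).

(* Word RAM.  A register, a memory cell, and a key or value of a hash table all
   hold a number below 2 ^ w.  Such a w-bit block stands for a fixed number of
   consecutive machine words, which is why the cost of an operation is left as
   an arbitrary positive constant [cost o] below rather than set to 1. *)

Inductive unop := Onot | Opopcount.

Inductive binop :=
  | Oadd | Osub | Omul | Odiv | Omod
  | Oand | Oor | Oxor | Oshl | Oshr
  | Oeq | Olt.

Fixpoint popcount_pos (x : positive) : N :=
  match x with
  | xH => 1%num
  | xO y => popcount_pos y
  | xI y => N.succ (popcount_pos y)
  end.

Definition popcount (x : N) : N :=
  match x with N0 => N0 | Npos y => popcount_pos y end.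

Definition N_of_bool (b : bool) : N := if b then 1%num else 0%num.

Definition wrap (w : nat) (x : N) : N := N.modulo x (N.pow 2 (N.of_nat w)).

Definition eval_unop (w : nat) (o : unop) (x : N) : N :=
  match o with
  | Onot => wrap w (N.lxor x (N.ones (N.of_nat w)))
  | Opopcount => wrap w (popcount x)
  end.

Definition eval_binop (w : nat) (o : binop) (x y : N) : N :=
  wrap w
    match o with
    | Oadd => N.add x y
    | Osub => N.sub (N.add x (N.pow 2 (N.of_nat w))) y
    | Omul => N.mul x y
    | Odiv => N.div x y
    | Omod => N.modulo x y
    | Oand => N.land x y
    | Oor => N.lor x y
    | Oxor => N.lxor x y
    | Oshl => N.shiftl x y
    | Oshr => N.shiftr x y
    | Oeq => N_of_bool (N.eqb x y)
    | Olt => N_of_bool (N.ltb x y)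
    end.

(* Registers are named by naturals, so that a program uses finitely many. *)
Inductive instr :=
  | Const (d : nat) (c : N)         (* d := c *)
  | Move (d x : nat)                (* d := x *)
  | Un (o : unop) (d x : nat)       (* d := o x *)
  | Bin (o : binop) (d x y : nat)   (* d := x o y *)
  | Fetch (d a : nat)                (* d := mem[a] *)
  | Store (a x : nat)               (* mem[a] := x *)
  | Insert (t key x : nat)          (* table[t][key] := x *)
  | Lookup (d f t key : nat).       (* d := table[t][key], f := 1 if the key is
                                       present, else d := 0, f := 0 *)

Inductive cmd :=
  | Skip
  | Do (i : instr)
  | Seq (c1 c2 : cmd)
  | If (x : nat) (c1 c2 : cmd)
  | While (x : nat) (c : cmd).

Inductive opcode :=
  | KConst | KMove | KUn (o : unop) | KBin (o : binop)
  | KFetch | KStore | KInsert | KLookup | KTest.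

Definition opcode_of (i : instr) : opcode :=
  match i with
  | Const _ _ => KConst
  | Move _ _ => KMove
  | Un o _ _ => KUn o
  | Bin o _ _ _ => KBin o
  | Fetch _ _ => KFetch
  | Store _ _ => KStore
  | Insert _ _ _ => KInsert
  | Lookup _ _ _ _ => KLookup
  end.

Record state := State {
  reg : nat -> N;
  mem : N -> N;
  table : N -> N -> option N }.

Definition set_reg (s : state) (d : nat) (v : N) : state :=
  State (fun r => if r == d then v else reg s r) (mem s) (table s).

Definition set_mem (s : state) (a v : N) : state :=
  State (reg s) (fun b => if N.eqb b a then v else mem s b) (table s).

Definition set_table (s : state) (t key v : N) : state :=
  State (reg s) (mem s)
    (fun t' key' =>
       if N.eqb t' t && N.eqb key' key then Some v else table s t' key').

Definition step (w : nat) (i : instr) (s : state) : state :=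
  match i with
  | Const d c => set_reg s d (wrap w c)
  | Move d x => set_reg s d (reg s x)
  | Un o d x => set_reg s d (eval_unop w o (reg s x))
  | Bin o d x y => set_reg s d (eval_binop w o (reg s x) (reg s y))
  | Fetch d a => set_reg s d (mem s (reg s a))
  | Store a x => set_mem s (reg s a) (reg s x)
  | Insert t key x => set_table s (reg s t) (reg s key) (reg s x)
  | Lookup d f t key =>
      match table s (reg s t) (reg s key) with
      | Some v => set_reg (set_reg s d v) f 1%num
      | None => set_reg (set_reg s d N0) f N0
      end
  end.

(* [exec w cost c s T s']: started in s, the command c halts in s' after time T. *)
Inductive exec (w : nat) (cost : opcode -> nat) :
    cmd -> state -> nat -> state -> Prop :=
  | exec_skip s : exec w cost Skip s 0 s
  | exec_do i s : exec w cost (Do i) s (cost (opcode_of i)) (step w i s)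
  | exec_seq c1 c2 s1 s2 s3 T1 T2 :
      exec w cost c1 s1 T1 s2 -> exec w cost c2 s2 T2 s3 ->
      exec w cost (Seq c1 c2) s1 (T1 + T2) s3
  | exec_if_true x c1 c2 s T s' :
      reg s x <> N0 -> exec w cost c1 s T s' ->
      exec w cost (If x c1 c2) s (cost KTest + T) s'
  | exec_if_false x c1 c2 s T s' :
      reg s x = N0 -> exec w cost c2 s T s' ->
      exec w cost (If x c1 c2) s (cost KTest + T) s'
  | exec_while_true x c s1 s2 s3 T1 T2 :
      reg s1 x <> N0 -> exec w cost c s1 T1 s2 ->
      exec w cost (While x c) s2 T2 s3 ->
      exec w cost (While x c) s1 (cost KTest + T1 + T2) s3
  | exec_while_false x c s :
      reg s x = N0 -> exec w cost (While x c) s (cost KTest) s.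

(* Input: n in register 0, k in register 1, and the k letters of the pattern in
   the memory cells 0, .., k-1; everything else is zero or empty. *)
Definition init_state (n k : nat) (p : 'S_k) : state :=
  State
    (fun r => match r with 0 => N.of_nat n | 1 => N.of_nat k | _ => N0 end)
    (fun a => nth N0 [seq N.of_nat x | x <- perm_word p] (N.to_nat a))
    (fun _ _ => None).

(* Output: table 0 maps each packed permutation of length n to its hit count. *)
Definition outputs_hits (n k : nat) (p : 'S_k) (s : state) : Prop :=
  forall t : 'S_n,
    table s N0 (pack_perm t) = Some (N.of_nat #|hits p t|).

(* Main.v *)
(** Mark the [i] largest letters of the pattern by replacing them by zeros, and let
    [f i x] (below, [level_matches k P i x]) be the number of matches of the marked
    pattern in a word [x] made of [i] zeros and the letters 1, .., m, where zeros
    match zeros only.  A match has to use every zero of [x].  If [x] arises from [y]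
    by inserting its largest letter [m] at position [l], the matches avoiding [m] are
    those of [y], while the matches using [m] send the letter [k - i] of the pattern
    to it; they exist only if the numbers of zeros in front of the two agree, and
    turning both into zeros then gives
      [f i x = f i y + (zeros before l = zeros before k - i) * f i.+1 (y with 0 at l)].
    The program tabulates [f i], for [i] going down to 0, on all such words of length
    at most [n], generated by repeated insertion of the next letter.  Each entry costs
    constant time, and there are at most
      [\sum_i \sum_(N <= n) N! / i! = O(n!)]
    of them.  Conversely, [n!] distinct keys have to be inserted into the output
    table. *)

Require Import Defs.
From Stdlib Require Import BinNat.
From mathcomp Require Import all_boot all_fingroup.
From mathcomp Require Import zify.

Set Implicit Arguments.
Unset Strict Implicit.
Unset Printing Implicit Defensive.

(** * Order isomorphism *)

Lemma mem_zip (S T : eqType) (s : seq S) (t : seq T) a b :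
  (a, b) \in zip s t -> a \in s /\ b \in t.
Proof.
elim: s t => [|x s IH] [|y t] //=; rewrite !inE => /orP[|/IH[-> ->]].
  by rewrite xpair_eqE => /andP[-> ->].
by rewrite !orbT.
Qed.

Lemma mem_zip_nth (S T : eqType) (x0 : S) (y0 : T) (s : seq S) (t : seq T) i :
  size s = size t -> i < size s -> (nth x0 s i, nth y0 t i) \in zip s t.
Proof. by move=> st hi; rewrite -nth_zip // mem_nth // size_zip -st minnn. Qed.

Definition same_order : rel (nat * nat) :=
  [rel c d | (c.1 < d.1) == (c.2 < d.2)].

Lemma order_iso_zip u v :
  order_iso u v =
  (size u == size v) && allrel same_order (zip u v) (zip u v).
Proof.
rewrite /order_iso; apply/andb_id2l => /eqP uv; have size_zip_uv := size_zip u v.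
rewrite -uv minnn in size_zip_uv.
apply/forallP/allrelP => [same c d|same i].
  move=> /(nthP (0, 0))[i hi <-] /(nthP (0, 0))[j hj <-].
  rewrite !nth_zip //=; rewrite size_zip_uv in hi hj.
  by have /forallP/(_ (Ordinal hj)) := same (Ordinal hi).
by apply/forallP => j; apply: (same (_, _) (_, _)); apply: mem_zip_nth.
Qed.

Lemma order_isoP u v :
  reflect (size u = size v /\ {in zip u v &, forall c d, (c.1 < d.1) = (c.2 < d.2)})
    (order_iso u v).
Proof.
rewrite order_iso_zip; apply: (iffP andP) => -[/eqP uv same]; split=> //.
  by move=> c d hc hd; have /eqP := allrelP same c d hc hd.
by apply/allrelP => c d hc hd; apply/eqP; exact: same.
Qed.

Lemma order_iso_size u v : order_iso u v -> size u = size v.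
Proof. by case/order_isoP. Qed.

Lemma order_iso_nth u v i j : order_iso u v -> i < size u -> j < size u ->
  (nth 0 u i < nth 0 u j) = (nth 0 v i < nth 0 v j).
Proof.
by case/order_isoP=> uv same hi hj; apply: (same (_, _) (_, _)); apply: mem_zip_nth.
Qed.

Lemma order_iso_insert_mem p1 p2 u1 u2 c d :
  size p1 = size u1 -> (c, d) \in zip (p1 ++ p2) (u1 ++ u2) ->
  order_iso (p1 ++ c :: p2) (u1 ++ d :: u2) = order_iso (p1 ++ p2) (u1 ++ u2).
Proof.
move=> size_eq; rewrite !order_iso_zip !size_cat /= size_eq !addnS eqSS !zip_cat //=.
move=> cd; congr andb; apply: eq_allrel_mem2 => e;
  rewrite mem_cat inE orbCA -mem_cat; case: eqP => // ->; by rewrite cd.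
Qed.

Lemma order_iso_insert_max p1 p2 u1 u2 t m : size p1 = size u1 ->
  all (gtn t) (p1 ++ p2) -> all (gtn m) (u1 ++ u2) ->
  order_iso (p1 ++ t :: p2) (u1 ++ m :: u2) = order_iso (p1 ++ p2) (u1 ++ u2).
Proof.
move=> size_eq /allP p_lt /allP u_lt.
have lt_max c : c \in zip (p1 ++ p2) (u1 ++ u2) -> c.1 < t /\ c.2 < m.
  by case: c => c1 c2 /mem_zip[/p_lt ? /u_lt].
have memE c : (c \in zip (p1 ++ t :: p2) (u1 ++ m :: u2)) =
    (c == (t, m)) || (c \in zip (p1 ++ p2) (u1 ++ u2)).
  by rewrite !zip_cat //= !mem_cat inE orbCA.
apply/order_isoP/order_isoP; rewrite !size_cat /= => -[size_eq_cat same]; split; try lia.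
  by move=> c d hc hd; apply: same; rewrite memE ?hc ?hd orbT.
move=> c d; rewrite !memE => /predU1P[->|hc] /predU1P[->|hd] /=.
- by rewrite !ltnn.
- by have [d1_lt d2_lt] := lt_max _ hd; rewrite !ltnNge (ltnW d1_lt) (ltnW d2_lt).
- by have [-> ->] := lt_max _ hc.
exact: same.
Qed.

Lemma nth_lt_max p1 p2 t i : all (gtn t) (p1 ++ p2) ->
  i < size (p1 ++ t :: p2) -> i != size p1 -> nth 0 (p1 ++ t :: p2) i < t.
Proof.
rewrite size_cat nth_cat /= => /allP p_lt i_lt ne; case: (ltnP i) => hi.
  by apply: (p_lt (nth 0 p1 i)); rewrite mem_cat mem_nth.
have [j jE jp2] : exists2 j, i - size p1 = j.+1 & j < size p2.
  by exists (i - (size p1).+1); lia.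
by rewrite jE; apply: (p_lt (nth 0 p2 j)); rewrite mem_cat orbC mem_nth.
Qed.

Lemma order_iso_max_index p1 p2 u1 u2 t m :
  all (gtn t) (p1 ++ p2) -> all (gtn m) (u1 ++ u2) ->
  order_iso (p1 ++ t :: p2) (u1 ++ m :: u2) -> size p1 = size u1.
Proof.
move=> p_lt u_lt iso; apply/eqP/negPn/negP => ne.
have nth_mid (q1 q2 : seq nat) c : nth 0 (q1 ++ c :: q2) (size q1) = c.
  by rewrite nth_cat ltnn subnn.
have size_lt (q1 q2 : seq nat) c : size q1 < size (q1 ++ c :: q2).
  by rewrite size_cat /= addnS ltnS leq_addr.
have size_u1_lt : size u1 < size (p1 ++ t :: p2) by rewrite (order_iso_size iso).
have size_p1_lt : size p1 < size (u1 ++ m :: u2) by rewrite -(order_iso_size iso).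
have := order_iso_nth iso size_u1_lt (size_lt _ _ _); rewrite !nth_mid.
rewrite (nth_lt_max p_lt size_u1_lt) 1?eq_sym // => /esym/ltnW.
by rewrite leqNgt (nth_lt_max u_lt size_p1_lt).
Qed.

(** * Marked patterns *)

(* A zero is a mark.  The extra leading zeros make marks match marks only. *)
Definition marked_iso (p u : seq nat) : bool := order_iso (0 :: p) (0 :: u).

Definition marks (x : seq nat) : nat := count (eq_op 0) x.

Lemma marks_cat x y : marks (x ++ y) = marks x + marks y.
Proof. exact: count_cat. Qed.

Lemma marks_eq0 x : all (ltn 0) x -> marks x = 0.
Proof.
move/allP=> x0; apply/eqP; rewrite -leqn0 leqNgt -has_count -all_predC.
by apply/allP => a /x0; rewrite /= lt0n eq_sym.
Qed.

Lemma marked_iso_size p u : marked_iso p u -> size p = size u.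
Proof. by move/order_iso_size => -[]. Qed.

Lemma marked_iso_map_eq0 p u : marked_iso p u -> map (eq_op 0) p = map (eq_op 0) u.
Proof.
move=> iso; have size_eq := marked_iso_size iso.
apply: (@eq_from_nth _ true); rewrite !size_map // => i hi.
rewrite !(nth_map 0) -?size_eq // ![0 == _]eq_sym !eqn0Ngt; congr negb.
exact: (@order_iso_nth _ _ 0 i.+1 iso).
Qed.

Lemma marked_iso_marks p u : marked_iso p u -> marks p = marks u.
Proof. by move/marked_iso_map_eq0/(congr1 (count id)); rewrite !count_map. Qed.

Lemma marked_iso_insert_mark p1 p2 u1 u2 : size p1 = size u1 ->
  marked_iso (p1 ++ 0 :: p2) (u1 ++ 0 :: u2) = marked_iso (p1 ++ p2) (u1 ++ u2).
Proof.
move=> size_eq; apply: (@order_iso_insert_mem (0 :: p1) _ (0 :: u1)).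
  by rewrite /= size_eq.
exact: mem_head.
Qed.

Lemma marked_iso_insert_max p1 p2 u1 u2 t m : size p1 = size u1 ->
  all (gtn t) (0 :: p1 ++ p2) -> all (gtn m) (0 :: u1 ++ u2) ->
  marked_iso (p1 ++ t :: p2) (u1 ++ m :: u2) = marked_iso (p1 ++ p2) (u1 ++ u2).
Proof.
by move=> size_eq; apply: (@order_iso_insert_max (0 :: p1) _ (0 :: u1)); rewrite /= size_eq.
Qed.

Lemma marked_iso_max_index p1 p2 u1 u2 t m :
  all (gtn t) (0 :: p1 ++ p2) -> all (gtn m) (0 :: u1 ++ u2) ->
  marked_iso (p1 ++ t :: p2) (u1 ++ m :: u2) -> size p1 = size u1.
Proof.
by move=> p_lt u_lt /(@order_iso_max_index (0 :: p1) _ (0 :: u1) _ _ _ p_lt u_lt)[].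
Qed.

Lemma marked_iso_nseq0 k u : marked_iso (nseq k 0) u = (u == nseq k 0).
Proof.
apply/idP/eqP => [iso|->].
  have size_eq := marked_iso_size iso; rewrite size_nseq in size_eq; rewrite size_eq.
  apply/all_pred1P; move/marked_iso_map_eq0: iso.
  rewrite map_nseq eqxx size_eq => marked_eq.
  by rewrite -(eq_all (a1 := eq_op 0)) // -[all _ _](all_map _ id) -marked_eq all_nseq orbT.
apply/order_isoP; split=> // c d.
suff zero e : e \in zip (0 :: nseq k 0) (0 :: nseq k 0) -> e = (0, 0).
  by move=> /zero-> /zero->.
case: e => a b /mem_zip[]; rewrite -[0 :: _]/(nseq k.+1 0) !mem_nseq.
by move=> /andP[_ /eqP->] /andP[_ /eqP->].
Qed.

Lemma order_iso_marked_iso u v :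
  all (ltn 0) u -> all (ltn 0) v -> order_iso u v = marked_iso u v.
Proof.
move=> /allP u0 /allP v0; rewrite /marked_iso.
apply/order_isoP/order_isoP => /= -[size_eq same]; split; last 1 first.
- by move=> c d hc hd; apply: same; rewrite inE ?hc ?hd orbT.
- by rewrite size_eq.
- move=> c d; rewrite !inE => /predU1P[->|hc] /predU1P[->|hd] //=.
  + by case: d hd => a b /mem_zip[/u0 /= -> /v0 /= ->].
  + exact: same.
by case: size_eq.
Qed.

(* Marks are matched in order, so equally many of them precede the matched marks. *)
Lemma marked_iso_mark_index p1 p2 u1 u2 : marks p1 = marks u1 ->
  marked_iso (p1 ++ 0 :: p2) (u1 ++ 0 :: u2) -> size p1 = size u1.
Proof.
suff rank (b1 b2 c1 c2 : seq bool) : count id b1 = count id c1 ->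
    b1 ++ true :: b2 = c1 ++ true :: c2 -> size b1 = size c1.
  move=> marks_eq /marked_iso_map_eq0; rewrite !map_cat /= => /rank.
  by rewrite !size_map !count_map; apply.
elim: b1 c1 => [|b b1 IH] [|c c1] //=.
- by move=> count_eq [? _]; move: count_eq; subst c.
- by move=> count_eq [? _]; move: count_eq; subst b.
by move=> count_eq [bc] /IH -> //; move: count_eq; rewrite bc !addnE => /addnI.
Qed.

(** * Counting marked matches *)

Fixpoint subseqs (T : Type) (x : seq T) : seq (seq T) :=
  if x is a :: y then map (cons a) (subseqs y) ++ subseqs y else [:: [::]].

Lemma size_subseqs T (x : seq T) : size (subseqs x) = 2 ^ size x.
Proof. by elim: x => //= a x IH; rewrite size_cat size_map IH expnS mul2n addnn. Qed.

Lemma map_subseqs T S (f : T -> S) x : subseqs (map f x) = map (map f) (subseqs x).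
Proof. by elim: x => //= a x ->; rewrite map_cat -!map_comp. Qed.

Lemma mem_subseqs (T : eqType) (x u : seq T) : (u \in subseqs x) = subseq u x.
Proof.
elim: x u => [|a x IH] [|b u] //=; rewrite mem_cat IH ?sub0seq ?orbT //.
case: eqP => [->|ba]; last first.
  by apply/orb_idl => /mapP[v _ []].
rewrite mem_map ?IH => [|v v' []] //.
by apply/orb_idr; apply: subseq_trans (subseq_cons _ _).
Qed.

Lemma subseqs_uniq (T : eqType) (x : seq T) : uniq x -> uniq (subseqs x).
Proof.
elim: x => //= a x IH /andP[ax /IH ux]; rewrite cat_uniq map_inj_uniq ?ux => [|u v []] //.
rewrite andbT; apply/hasPn => u; rewrite mem_subseqs => /mem_subseq ux'.
by apply: contra ax => /mapP[v _ uE]; apply: ux'; rewrite uE mem_head.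
Qed.

Lemma perm_enum_subseqs (T : finType) :
  perm_eq [seq enum A | A : {set T}] (subseqs (enum T)).
Proof.
have enumE (A : {pred T}) : enum A = filter (mem A) (enum T).
  by rewrite enumT.
apply: uniq_perm; last 1 first.
- move=> u; rewrite mem_subseqs; apply/mapP/(subseq_uniqP (enum_uniq T)) => [[A _ ->]|uE].
    by rewrite {1}enumE; apply: eq_filter => i; rewrite /= mem_enum.
  exists [set i in u]; first exact: mem_enum.
  by rewrite enumE {1}uE; apply: eq_filter => i; rewrite /= inE.
- rewrite map_inj_uniq ?enum_uniq // => A B AB; apply/setP => i.
  by rewrite -mem_enum AB mem_enum.
exact/subseqs_uniq/enum_uniq.
Qed.

Lemma count_subseqs_cons T (F : pred (seq T)) a y :
  count F (subseqs (a :: y)) =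
  count (fun u => F (a :: u)) (subseqs y) + count F (subseqs y).
Proof. by rewrite /= count_cat count_map. Qed.

Lemma count_subseqs_insert T (F : pred (seq T)) y1 c y2 :
  count F (subseqs (y1 ++ c :: y2)) = count F (subseqs (y1 ++ y2)) +
    \sum_(u1 <- subseqs y1) count (fun u2 => F (u1 ++ c :: u2)) (subseqs y2).
Proof.
elim: y1 F => [|a y1 IH] F.
  by rewrite cat0s /= big_seq1 count_cat count_map addnC.
rewrite !cat_cons !count_subseqs_cons !IH /= big_cat big_map /=; lia.
Qed.

Lemma count_subseqs_self (T : eqType) (x : seq T) : count (pred1 x) (subseqs x) = 1.
Proof.
elim: x => // a x IH; rewrite count_subseqs_cons.
rewrite (eq_count (a2 := pred1 x)) => [|u]; last by rewrite /= eqseq_cons eqxx.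
rewrite IH; congr _.+1; apply/count_memPn; rewrite mem_subseqs.
by apply/negP => /size_subseq; rewrite ltnn.
Qed.

Definition matches (p x : seq nat) : nat := count (marked_iso p) (subseqs x).

Lemma matches_le_exp p x : matches p x <= 2 ^ size x.
Proof. by rewrite -size_subseqs count_size. Qed.

Lemma matches_eq0 p x : (forall u, subseq u x -> ~~ marked_iso p u) -> matches p x = 0.
Proof.
move=> no_iso; apply/eqP; rewrite -leqn0 leqNgt -has_count.
by apply/hasPn => u; rewrite mem_subseqs => /no_iso.
Qed.

Lemma matches_short p x : size x < size p -> matches p x = 0.
Proof.
move=> xp; apply: matches_eq0 => u /size_subseq ux.
by apply: contraTN xp => /marked_iso_size ->; rewrite -leqNgt.
Qed.

Lemma matches_few_marks p x : marks x < marks p -> matches p x = 0.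
Proof.
move=> xp; apply: matches_eq0 => u ux.
by apply: contraTN xp => /marked_iso_marks ->; rewrite -leqNgt leq_count_subseq.
Qed.

Lemma matches_nseq0 k : matches (nseq k 0) (nseq k 0) = 1.
Proof.
by rewrite -(count_subseqs_self (nseq k 0)); apply: eq_count => u; exact: marked_iso_nseq0.
Qed.

Lemma matches_nseq0_insert k y1 m y2 : 0 < m ->
  matches (nseq k 0) (y1 ++ m :: y2) = matches (nseq k 0) (y1 ++ y2).
Proof.
move=> m_gt0; rewrite /matches count_subseqs_insert big1 ?addn0 // => u1 _.
rewrite -[RHS](count_pred0 (subseqs y2)); apply: eq_count => u2 /=.
rewrite marked_iso_nseq0; apply/negP => /eqP u_eq.
have : m \in nseq k 0 by rewrite -u_eq mem_cat mem_head orbT.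
by rewrite mem_nseq => /andP[_ /eqP m_eq0]; rewrite m_eq0 in m_gt0.
Qed.

(* All the marks of [y1 ++ y2] are used on both sides, so the number of marks of
   [y1] tells which letter of the pattern the letter [m] is matched to. *)
Lemma marked_iso_max_to_mark q1 t q2 y1 m y2 u1 u2 :
  all (gtn t) (0 :: q1 ++ q2) -> all (gtn m) (0 :: y1 ++ y2) ->
  marks (y1 ++ y2) = marks (q1 ++ q2) -> subseq u1 y1 -> subseq u2 y2 ->
  marked_iso (q1 ++ t :: q2) (u1 ++ m :: u2) =
  (marks y1 == marks q1) && marked_iso (q1 ++ 0 :: q2) (u1 ++ 0 :: u2).
Proof.
move=> q_lt y_lt; rewrite !marks_cat => marks_yq u1_y1 u2_y2.
have u_lt : all (gtn m) (0 :: u1 ++ u2).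
  have /allP y_ltP := y_lt; apply/allP => a; rewrite inE => /predU1P[->|].
    exact/y_ltP/mem_head.
  by move=> /(mem_subseq (cat_subseq u1_y1 u2_y2)) ay; apply: y_ltP; rewrite inE ay orbT.
have marks_u1 := leq_count_subseq (eq_op 0) u1_y1.
have marks_u2 := leq_count_subseq (eq_op 0) u2_y2.
have marks_y1 : marked_iso (q1 ++ 0 :: q2) (u1 ++ 0 :: u2) -> marks y1 = marks u1.
  move/marked_iso_marks; rewrite !marks_cat /marks /= -!/(marks _).
  by move: marks_u1 marks_u2 marks_yq; rewrite -!/(marks _); lia.
apply/idP/andP => [iso|[/eqP marks_y1q1 iso]].
  have size_eq := marked_iso_max_index q_lt u_lt iso.
  have iso0 : marked_iso (q1 ++ 0 :: q2) (u1 ++ 0 :: u2).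
    by rewrite marked_iso_insert_mark // -(marked_iso_insert_max size_eq q_lt u_lt).
  split=> //; rewrite (marks_y1 iso0); have := marked_iso_map_eq0 iso0.
  rewrite !map_cat => /eqP; rewrite eqseq_cat ?size_map // => /andP[/eqP marked_eq _].
  by have := congr1 (count id) marked_eq; rewrite !count_map /marks => ->.
have size_eq : size q1 = size u1.
  by apply: (marked_iso_mark_index _ iso); rewrite -marks_y1q1 marks_y1.
rewrite (marked_iso_insert_max size_eq q_lt u_lt).
by rewrite -(marked_iso_insert_mark q2 u2 size_eq).
Qed.

Lemma matches_insert_max q1 t q2 y1 m y2 :
  all (gtn t) (0 :: q1 ++ q2) -> all (gtn m) (0 :: y1 ++ y2) ->
  marks (y1 ++ y2) = marks (q1 ++ q2) ->
  matches (q1 ++ t :: q2) (y1 ++ m :: y2) =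
  matches (q1 ++ t :: q2) (y1 ++ y2) +
    (marks y1 == marks q1) * matches (q1 ++ 0 :: q2) (y1 ++ 0 :: y2).
Proof.
move=> q_lt y_lt marks_yq; have too_few : matches (q1 ++ 0 :: q2) (y1 ++ y2) = 0.
  by apply: matches_few_marks; rewrite marks_yq !marks_cat /marks /= addnS.
rewrite /matches !count_subseqs_insert -!/(matches _ _) too_few add0n; congr (_ + _).
rewrite big_distrr /=; apply: eq_big_seq => u1; rewrite mem_subseqs => u1_y1.
transitivity (count (fun u2 => (marks y1 == marks q1) &&
    marked_iso (q1 ++ 0 :: q2) (u1 ++ 0 :: u2)) (subseqs y2)).
  apply: eq_in_count => u2; rewrite mem_subseqs => u2_y2.
  exact: marked_iso_max_to_mark u1_y1 u2_y2.
by case: eqP => _; rewrite ?mul1n // mul0n; exact: count_pred0.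
Qed.

(** * The recurrence for a permutation pattern *)

Definition insert_at l (c : nat) (y : seq nat) := take l y ++ c :: drop l y.

Lemma perm_insert_at l c y : perm_eq (insert_at l c y) (c :: y).
Proof. by rewrite /insert_at perm_catC /= perm_cons perm_catC cat_take_drop. Qed.

Lemma size_insert_at l c y : size (insert_at l c y) = (size y).+1.
Proof. exact: perm_size (perm_insert_at l c y). Qed.

Definition mark_above t (P : seq nat) := [seq if a <= t then a else 0 | a <- P].

Definition exceed_before t (P : seq nat) := count (ltn t) (take (index t P) P).

Lemma exceed_before_rcons t s v :
  exceed_before t (rcons s v) = exceed_before t s + (t < v) * (t \notin s).
Proof.
rewrite /exceed_before -cats1 index_cat; case: (boolP (t \in s)) => ts.
  by rewrite muln0 addn0 takel_cat // ltnW // index_mem.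
rewrite muln1 /=; case: eqP => [-> | _].
  by rewrite ltnn !addn0 take_size_cat // memNindex // take_size.
by rewrite take_oversize ?size_cat //= memNindex // take_size count_cat /= addn0.
Qed.

Lemma exceed_before_le t s : exceed_before t s <= size s.
Proof. by apply: leq_trans (count_size _ _) _; rewrite size_take_min geq_minr. Qed.

Lemma marks_mark_above t P : all (ltn 0) P -> marks (mark_above t P) = count (ltn t) P.
Proof.
move=> /allP P0; rewrite /marks count_map; apply: eq_in_count => a /P0.
by rewrite /= lt0n eq_sym => /negPf a0; case: leqP => _; rewrite ?a0.
Qed.

Lemma mark_above_id t P : all (leq^~ t) P -> mark_above t P = P.
Proof. by move=> /allP Pt; apply: map_id_in => a /Pt ->. Qed.

Lemma mark_above0 P : mark_above 0 P = nseq (size P) 0.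
Proof. by elim: P => //= a P ->; case: a. Qed.

Lemma mark_above_split t P : uniq P -> all (ltn 0) P -> t.+1 \in P ->
  exists q1 q2,
    [/\ mark_above t.+1 P = q1 ++ t.+1 :: q2, mark_above t P = q1 ++ 0 :: q2,
        all (gtn t.+1) (0 :: q1 ++ q2) & marks q1 = exceed_before t.+1 P].
Proof.
move=> uP P0 tP; pose P1 := take (index t.+1 P) P; pose P2 := drop (index t.+1 P).+1 P.
have PE : P = P1 ++ t.+1 :: P2.
  by rewrite -{1}(nth_index 0 tP) -drop_nth ?index_mem // cat_take_drop.
have [tP1 tP2] : t.+1 \notin P1 /\ t.+1 \notin P2.
  by move: uP; rewrite PE cat_uniq /= negb_or -!andbA => /and5P[_ ? _ ? _].
have lower Q : t.+1 \notin Q -> mark_above t.+1 Q = mark_above t Q.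
  move=> tQ; apply/eq_in_map => a aQ; rewrite leq_eqVlt ltnS.
  by case: eqP => // at1; rewrite -at1 aQ in tQ.
exists (mark_above t P1), (mark_above t P2); split.
- by rewrite {1}PE /mark_above map_cat /= leqnn -!/(mark_above _ _) !lower.
- by rewrite {1}PE /mark_above map_cat /= ltnn.
- rewrite /= -map_cat all_map; apply/allP => a _ /=.
  by case: ifP.
rewrite /exceed_before -/P1 -lower // marks_mark_above //.
by move: P0; rewrite PE all_cat => /andP[].
Qed.

Lemma count_ltn_iota t k : count (ltn t) (iota 1 k) = k - t.
Proof.
by elim: k => // k IH; rewrite -{1}(addn1 k) iotaD count_cat IH /=; case: ltnP; lia.
Qed.

Section PermutationPattern.

Variables (k : nat) (P : seq nat).
Hypothesis P_perm : perm_eq P (iota 1 k).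

Definition level_matches i x := matches (mark_above (k - i) P) x.

Lemma pattern_size : size P = k.
Proof. by rewrite (perm_size P_perm) size_iota. Qed.

Lemma pattern_gt0 : all (ltn 0) P.
Proof. by apply/allP => a; rewrite (perm_mem P_perm) mem_iota => /andP[]. Qed.

Lemma level_matches_short i x : size x < k -> level_matches i x = 0.
Proof. by move=> xk; apply: matches_short; rewrite size_map pattern_size. Qed.

Lemma level_matches_marks i : i <= k -> level_matches i (nseq i 0) = (i == k).
Proof.
rewrite leq_eqVlt => /predU1P[->|ik]; last first.
  by rewrite level_matches_short ?size_nseq // ltn_eqF.
by rewrite eqxx /level_matches subnn mark_above0 pattern_size matches_nseq0.
Qed.

Lemma level_matches_full_insert l m y : 0 < m ->
  level_matches k (insert_at l m y) = level_matches k y.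
Proof.
move=> m0; rewrite /level_matches subnn mark_above0 matches_nseq0_insert //.
by rewrite cat_take_drop.
Qed.

Lemma level_matches_insert i l m y : i < k -> all (gtn m) (0 :: y) -> marks y = i ->
  level_matches i (insert_at l m y) =
  level_matches i y +
    (marks (take l y) == exceed_before (k - i) P) * level_matches i.+1 (insert_at l 0 y).
Proof.
move=> ik y_lt marks_y; rewrite /level_matches -subSS subSn //.
set t := k - i.+1.
have tP : t.+1 \in P by rewrite (perm_mem P_perm) mem_iota; lia.
have uP : uniq P by rewrite (perm_uniq P_perm) iota_uniq.
have [q1 [q2 [-> qE q_lt <-]]] := mark_above_split uP pattern_gt0 tP.
have := @matches_insert_max q1 t.+1 q2 (take l y) m (drop l y).
rewrite cat_take_drop marks_y qE; apply=> //.
have := marks_mark_above t pattern_gt0.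
by rewrite qE !marks_cat (seq.permP P_perm) count_ltn_iota /marks /=; lia.
Qed.

End PermutationPattern.

(** * Hits as matches *)

Lemma perm_word_iota n (t : 'S_n) : perm_eq (perm_word t) (iota 1 n).
Proof.
apply: uniq_perm; rewrite ?iota_uniq //.
  by rewrite map_inj_uniq ?enum_uniq // => i j [] /val_inj/perm_inj.
move=> a; rewrite mem_iota; apply/mapP/idP => [[i _ ->]|/andP[a0 an]].
  by rewrite /= add1n ltnS ltn_ord.
have an' : a.-1 < n by lia.
exists (t^-1 (Ordinal an'))%g; first by rewrite mem_enum.
by rewrite permKV prednK.
Qed.

Lemma perm_word_gt0 n (t : 'S_n) : all (ltn 0) (perm_word t).
Proof. exact: pattern_gt0 (perm_word_iota t). Qed.

Lemma perm_word_inj n : injective (@perm_word n).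
Proof.
move=> s t /eq_in_map st; apply/permP => i; apply/val_inj.
by have [] := st i (mem_enum _ i).
Qed.

Lemma card_hits k n (p : 'S_k) (t : 'S_n) :
  #|hits p t| = level_matches k (perm_word p) 0 (perm_word t).
Proof.
have -> : #|hits p t| = count (order_iso (perm_word p)) (subseqs (perm_word t)).
  rewrite {2}/perm_word map_subseqs count_map -(seq.permP (perm_enum_subseqs _)).
  rewrite -sum1_count big_image_cond -sum1_card.
  by apply: eq_bigl => A; rewrite inE.
rewrite /level_matches subn0 mark_above_id; last first.
  by apply/allP => a; rewrite (perm_mem (perm_word_iota p)) mem_iota add1n ltnS => /andP[].
apply: eq_in_count => u; rewrite mem_subseqs => /mem_subseq ut.
apply: order_iso_marked_iso; first exact: perm_word_gt0.
by apply/allP => a /ut; move/allP: (perm_word_gt0 t); apply.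
Qed.

(** * Packed words *)

Definition radix B (x : seq nat) := foldr (fun a r => a + r * B) 0 x.

Lemma radix_cat B x y : radix B (x ++ y) = radix B x + B ^ size x * radix B y.
Proof.
elim: x => [|a x IH] /=; first by rewrite mul1n.
by rewrite IH expnS mulnDl addnA mulnAC (mulnC B).
Qed.

Lemma radix_nseq0 B i : radix B (nseq i 0) = 0.
Proof. by elim: i => //= i ->. Qed.

Lemma radix_lt B x : all (gtn B) x -> radix B x < B ^ size x.
Proof.
elim: x => //= a x IH /andP[aB /IH xB]; rewrite expnS.
by have := leq_mul (leqnn B) xB; rewrite mulnS (mulnC B (radix B x)); lia.
Qed.

Lemma radix_drop B y l : radix B (drop l y) = nth 0 y l + radix B (drop l.+1 y) * B.
Proof.
case: (ltnP l (size y)) => ly; first by rewrite (drop_nth 0 ly).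
by rewrite nth_default // !drop_oversize // ltnW.
Qed.

Lemma radix_drop_mod B y l : all (gtn B) y -> 0 < B -> radix B (drop l y) %% B = nth 0 y l.
Proof.
move=> /allP yB B0; rewrite radix_drop addnC modnMDl modn_small //.
by case: (ltnP l (size y)) => ly; [apply/yB/mem_nth|rewrite nth_default].
Qed.

Lemma radix_drop_div B y l : all (gtn B) y -> 0 < B ->
  radix B (drop l y) %/ B = radix B (drop l.+1 y).
Proof.
move=> yB B0; rewrite {1}radix_drop addnC divnMDl // divn_small ?addn0 //.
by rewrite -(radix_drop_mod l yB B0) ltn_pmod.
Qed.

Lemma radix_takeS B y l : radix B (take l.+1 y) = radix B (take l y) + B ^ l * nth 0 y l.
Proof.
case: (ltnP l (size y)) => ly; last first.
  by rewrite nth_default // muln0 addn0 !take_oversize // ltnW.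
by rewrite (take_nth 0) // -cats1 radix_cat size_takel 1?ltnW //= mul0n addn0.
Qed.

Lemma marks_takeS y l :
  marks (take l.+1 y) = marks (take l y) + (nth 0 y l == 0) * (l < size y).
Proof.
case: (ltnP l (size y)) => ly; last first.
  by rewrite muln0 addn0 !take_oversize // ltnW.
by rewrite (take_nth 0) // -cats1 marks_cat muln1 /marks /= addn0 eq_sym.
Qed.

Lemma radix_insert_at B l c y : l <= size y ->
  radix B (insert_at l c y) = radix B (take l y) + B ^ l * (c + radix B (drop l y) * B).
Proof. by move=> ly; rewrite /insert_at radix_cat size_takel. Qed.

(* In general, words with the same packing may differ in trailing zeros. *)
Lemma radix_inj B x y : all (gtn B) x -> all (gtn B) y ->
  marks x = marks y -> radix B x = radix B y -> x = y.
Proof.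
have radix0 z : 0 < B -> radix B z = 0 -> marks z = size z.
  rewrite /marks => B0; elim: z => //= a z IH /eqP; rewrite addn_eq0 muln_eq0.
  by case/andP => /eqP-> /orP[/eqP/IH-> //|]; lia.
elim: x y => [|a x IH] [|b y] //.
- move=> _ /andP[bB _] marks_xy /esym/(radix0 (b :: y)); rewrite -marks_xy => size_eq.
  by have := size_eq (leq_ltn_trans (leq0n _) bB).
- move=> /andP[aB _] _ marks_xy /(radix0 (a :: x)); rewrite marks_xy => size_eq.
  by have := size_eq (leq_ltn_trans (leq0n _) aB).
move=> /andP[/= aB xB] /andP[/= bB yB] marks_xy xy.
have B0 : 0 < B by lia.
have ab : a = b.
  by have := congr1 (modn^~ B) xy; rewrite ![_ + _ * B]addnC !modnMDl !modn_small.
rewrite ab in marks_xy xy *; congr (_ :: _); apply: IH => //.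
  by move: marks_xy; rewrite /marks /= => /addnI.
by move/addnI/eqP: xy; rewrite eqn_pmul2r // => /eqP.
Qed.

Lemma of_nat_expn2 w : N.pow 2 (N.of_nat w) = N.of_nat (2 ^ w).
Proof. lia. Qed.

Lemma pack_radix b x : pack b x = N.of_nat (radix (2 ^ b) x).
Proof. by elim: x => //= a x ->; rewrite N.shiftl_mul_pow2 of_nat_expn2; lia. Qed.

(** * Enumeration of the marked words *)

Definition marked_word i m (x : seq nat) := perm_eq x (nseq i 0 ++ iota 1 m).

Lemma size_marked_word i m x : marked_word i m x -> size x = i + m.
Proof. by move/perm_size; rewrite size_cat size_nseq size_iota. Qed.

Lemma marks_marked_word i m x : marked_word i m x -> marks x = i.
Proof.
move/seq.permP/(_ (eq_op 0)); rewrite -!/(marks _) marks_cat => ->.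
rewrite (@marks_eq0 (iota 1 m)); first by rewrite /marks count_nseq mul1n addn0.
by apply/allP => a; rewrite mem_iota => /andP[].
Qed.

Lemma marked_word_lt i m x B : marked_word i m x -> m < B -> all (gtn B) x.
Proof.
move=> /perm_all -> mB; rewrite all_cat all_nseq /=; apply/andP; split; first by lia.
by apply/allP => a; rewrite mem_iota /=; lia.
Qed.

Lemma perm_nseq0_iotaS i m :
  perm_eq (nseq i 0 ++ iota 1 m.+1) (m.+1 :: nseq i 0 ++ iota 1 m).
Proof. by rewrite -(addn1 m) iotaD catA perm_catC /= add1n addn1. Qed.

Lemma marked_word_insert l i m y :
  marked_word i m y -> marked_word i m.+1 (insert_at l m.+1 y).
Proof.
rewrite /marked_word => ym; apply: perm_trans (perm_insert_at _ _ _) _.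
by rewrite perm_sym (perm_trans (perm_nseq0_iotaS _ _)) // perm_cons perm_sym.
Qed.

Lemma marked_word_insert_mark l i m y :
  marked_word i m y -> marked_word i.+1 m (insert_at l 0 y).
Proof.
by rewrite /marked_word => ym; rewrite (perm_trans (perm_insert_at _ _ _)) //= perm_cons.
Qed.

Definition insertions c y := [seq insert_at l c y | l <- iota 0 (size y).+1].

Fixpoint marked_words i m : seq (seq nat) :=
  if m is m'.+1 then flatten [seq insertions m y | y <- marked_words i m']
  else [:: nseq i 0].

Lemma insert_at_index c (x : seq nat) : c \in x ->
  exists2 y, x = insert_at (index c x) c y & index c x <= size y.
Proof.
move=> cx; have lx : index c x < size x by rewrite index_mem.
have sz : size (take (index c x) x) = index c x by rewrite size_takel // ltnW.
exists (take (index c x) x ++ drop (index c x).+1 x); last first.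
  by rewrite size_cat sz leq_addr.
rewrite /insert_at take_size_cat // drop_size_cat //.
by rewrite -[X in X :: _](nth_index 0 cx) -drop_nth // cat_take_drop.
Qed.

Lemma mem_marked_words i m x : (x \in marked_words i m) = marked_word i m x.
Proof.
elim: m x => [|m IH] x /=.
  rewrite inE /marked_word cats0; apply/eqP/idP => [-> //|xp].
  rewrite -(size_nseq i 0) -(perm_size xp); apply/all_pred1P.
  by rewrite (perm_all _ xp) all_nseq /= eqxx orbT.
apply/flatten_mapP/idP => [[y]|xm].
  by rewrite IH => ym /mapP[l _ ->]; apply: marked_word_insert.
have mx : m.+1 \in x by rewrite (perm_mem xm) mem_cat mem_iota; lia.
have [y xE ly] := insert_at_index mx; exists y; last first.
  by apply/mapP; exists (index m.+1 x); first by rewrite mem_iota.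
rewrite IH /marked_word -(perm_cons m.+1).
apply: (@perm_trans _ x); first by rewrite perm_sym {1}xE perm_insert_at.
exact: perm_trans xm (perm_nseq0_iotaS _ _).
Qed.

Lemma size_flatten_insertions i m c s : all (marked_word i m) s ->
  size (flatten [seq insertions c y | y <- s]) = size s * (i + m).+1.
Proof.
elim: s => //= y s IH /andP[/size_marked_word ym /IH sz].
by rewrite size_cat sz size_map size_iota ym mulSn.
Qed.

Lemma all_marked_words i m : all (marked_word i m) (marked_words i m).
Proof. by apply/allP => x; rewrite mem_marked_words. Qed.

Lemma size_marked_wordsS i m :
  size (marked_words i m.+1) = size (marked_words i m) * (i + m).+1.
Proof. exact/size_flatten_insertions/all_marked_words. Qed.

Lemma size_marked_words i m : i`! * size (marked_words i m) = (i + m)`!.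
Proof.
elim: m => [|m IH]; first by rewrite addn0 muln1.
by rewrite size_marked_wordsS mulnA IH addnS factS mulnC.
Qed.

Lemma size_marked_words_gt0 i m : 0 < size (marked_words i m).
Proof. by have := fact_gt0 (i + m); rewrite -size_marked_words muln_gt0 => /andP[]. Qed.

Fixpoint shorter_words i d : seq (seq nat) :=
  if d is m.+1 then shorter_words i m ++ marked_words i m else [::].

Lemma mem_shorter_words i d x :
  reflect (exists2 m, m < d & marked_word i m x) (x \in shorter_words i d).
Proof.
elim: d => [|d IH] /=; first by apply: (iffP idP) => // -[].
rewrite mem_cat mem_marked_words; apply: (iffP orP) => [[/IH[m md xm]|xd]|[m]].
- by exists m => //; apply: ltnW.
- by exists d.
rewrite ltnS leq_eqVlt => /predU1P[-> | md xm]; first by right.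
by left; apply/IH; exists m.
Qed.

Lemma size_shorter_words i d :
  size (shorter_words i d) = \sum_(m < d) size (marked_words i m).
Proof.
by elim: d => [|d IH]; rewrite ?big_ord0 // big_ord_recr /= size_cat IH.
Qed.

Lemma leq_size_shorter_words i d e :
  d <= e -> size (shorter_words i d) <= size (shorter_words i e).
Proof.
by move=> /subnK <-; elim: (e - d) => //= c; rewrite size_cat; lia.
Qed.

Lemma sum_fact_le i d : \sum_(m < d.+1) (i + m)`! <= 2 * (i + d)`!.
Proof.
elim: d => [|d IH]; first by rewrite big_ord1 leq_pmull.
rewrite big_ord_recr /= addnS mul2n -addnn leq_add2r.
case: (posnP (i + d)) => [/eqP|id]; last first.
  by apply: leq_trans IH _; rewrite factS leq_mul.
by rewrite addn_eq0 => /andP[/eqP-> /eqP->]; rewrite big_ord1.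
Qed.

Definition level_size i n := size (shorter_words i (n - i).+1).

Lemma level_size_gt0 i n : 0 < level_size i n.
Proof. by rewrite /level_size /= size_cat addn_gt0 size_marked_words_gt0 orbT. Qed.

Lemma level_size_fact i n : i <= n -> i`! * level_size i n <= 2 * n`!.
Proof.
move=> ik; rewrite /level_size size_shorter_words big_distrr /=.
under eq_bigr do rewrite size_marked_words.
by have := sum_fact_le i (n - i); rewrite subnKC.
Qed.

Lemma leq_exp2_fact i : 2 ^ i <= 2 * i`!.
Proof.
elim: i => // -[|i] IH //; rewrite expnS factS mulnCA.
by apply: leq_trans (leq_mul (leqnn 2) IH) _; rewrite leq_mul2r orbC.
Qed.

Lemma sum_geometric_le K A (F : nat -> nat) : (forall i, i <= K -> 2 ^ i * F i <= A) ->
  \sum_(i < K.+1) F i <= 2 * A.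
Proof.
move=> hF; suff: 2 ^ K * \sum_(i < K.+1) F i + A <= 2 ^ K * (2 * A).
  move/(leq_trans (leq_addr _ _)); by rewrite leq_pmul2l ?expn_gt0.
elim: K hF => [|K IH] hF.
  by have := hF 0 (leqnn 0); rewrite big_ord1 !mul1n; lia.
rewrite big_ord_recr /= !expnS -!mulnA mulnDr.
have := IH (fun i iK => hF i (leqW iK)); have := hF K.+1 (leqnn _).
rewrite expnS -!mulnA; move: (2 ^ K) (F K.+1) (\sum_(i < K.+1) F i) => x y z; nia.
Qed.

Lemma sum_level_size_le K n : K <= n -> \sum_(i < K.+1) level_size i n <= 8 * n`!.
Proof.
move=> Kn; rewrite -[8]/(2 * 4) -mulnA.
apply: (sum_geometric_le (F := level_size^~ n)) => i iK.
apply: leq_trans (leq_mul (leq_exp2_fact i) (leqnn _)) _.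
by rewrite -[4]/(2 * 2) -!mulnA leq_mul2l level_size_fact // (leq_trans iK).
Qed.

Lemma sqr_le_fact n : 1 < n -> n.+1 ^ 2 <= 6 * n`!.
Proof.
case: n => [|[|n]] // _; elim: n => // n IH; rewrite factS.
by rewrite mulnCA; apply: leq_trans (leq_mul (leqnn _) IH); rewrite -!mulnn; nia.
Qed.

Lemma fact_lt_exp n : 1 < n -> n.+1`! < n.+1 ^ n.
Proof.
case: n => [|[|n]] // _; elim: n => // n IH.
rewrite factS expnS ltn_pmul2l //; apply: leq_trans IH _.
by rewrite leq_exp2r.
Qed.

(** * Running time *)

Definition unit_cost (_ : opcode) := 1.

Definition opcodes : seq opcode :=
  [:: KConst; KMove; KUn Onot; KUn Opopcount; KBin Oadd; KBin Osub; KBin Omul;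
      KBin Odiv; KBin Omod; KBin Oand; KBin Oor; KBin Oxor; KBin Oshl; KBin Oshr;
      KBin Oeq; KBin Olt; KFetch; KStore; KInsert; KLookup; KTest].

Lemma cost_le_sum (cost : opcode -> nat) o : cost o <= sumn (map cost opcodes).
Proof. by case: o => [| |[]|[]| | | | |] /=; lia. Qed.

Lemma exec_unit_cost w cost M c s T s' : (forall o, 0 < cost o <= M) ->
  exec w unit_cost c s T s' ->
  exists2 T', exec w cost c s T' s' & T <= T' <= M * T.
Proof.
move=> hM; have hT := hM KTest; elim=> {c s T s'}.
- by move=> s; exists 0; [constructor|rewrite muln0].
- by move=> i s; exists (cost (opcode_of i)); [constructor|rewrite muln1 hM].
- move=> c1 c2 s1 s2 s3 T1 T2 _ [T1' e1 h1] _ [T2' e2 h2].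
  by exists (T1' + T2'); [apply: exec_seq e1 e2|rewrite mulnDr; lia].
- move=> x c1 c2 s T s' hx _ [T' e h].
  exists (cost KTest + T'); first exact: exec_if_true.
  by rewrite /unit_cost mulnDr muln1; lia.
- move=> x c1 c2 s T s' hx _ [T' e h].
  exists (cost KTest + T'); first exact: exec_if_false.
  by rewrite /unit_cost mulnDr muln1; lia.
- move=> x c s1 s2 s3 T1 T2 hx _ [T1' e1 h1] _ [T2' e2 h2].
  exists (cost KTest + T1' + T2'); first exact: exec_while_true e1 e2.
  by rewrite /unit_cost !mulnDr muln1; lia.
- move=> x c s hx; exists (cost KTest); first exact: exec_while_false.
  by rewrite muln1 hM.
Qed.

Lemma count_keys_le_time w c s T s' t (L : seq N) : uniq L ->
  exec w unit_cost c s T s' ->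
  count (fun key => table s' t key) L <= count (fun key => table s t key) L + T.
Proof.
move=> uL; elim=> {c s T s'} //; try by intros; lia.
move=> i s; case: i => [d c|d x|o d x|o d x y|d a|a x|t' key x|d f t' key] /=;
  try exact: leq_addr.
  apply: (@leq_trans (count (predU (fun key => table s t key) (pred1 (reg s key))) L)).
    apply: sub_count => z /=; case: ifP => [/andP[_ /N.eqb_eq ->] _|_ -> //].
    by rewrite eqxx orbT.
  have := count_predUI (fun key => table s t key) (pred1 (reg s key)) L.
  by rewrite [count (pred1 _) _]count_uniq_mem // /unit_cost; case: (_ \in _) => /=; lia.
by case: (table s _ _) => [v|] /=; apply: leq_addr.
Qed.

(** * The word RAM on natural numbers *)

Record nstate := NState {
  nreg : nat -> nat;
  nmem : nat -> nat;
  ntable : nat -> nat -> option nat }.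

Definition represents (s : state) (g : nstate) : Prop :=
  [/\ forall r, reg s r = N.of_nat (nreg g r),
      forall a, Defs.mem s (N.of_nat a) = N.of_nat (nmem g a) &
      forall t key, table s (N.of_nat t) (N.of_nat key) =
        omap N.of_nat (ntable g t key)].

Definition same_memory (g g' : nstate) : Prop :=
  nmem g' = nmem g /\ ntable g' = ntable g.

Definition nset_reg (g : nstate) d v :=
  NState (fun r => if r == d then v else nreg g r) (nmem g) (ntable g).

(* The operations that the program below does not use get the junk value 0; they are
   rejected by [binop_fits]. *)
Definition nbinop (o : binop) (x y : nat) : nat :=
  match o with
  | Oadd => x + y
  | Osub => x - y
  | Omul => x * y
  | Odiv => x %/ y
  | Omod => x %% y
  | Oeq => x == y
  | Olt => x < y
  | _ => 0
  end.

Definition binop_fits w (o : binop) (x y : nat) : bool :=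
  match o with
  | Oadd | Omul | Odiv | Omod => nbinop o x y < 2 ^ w
  | Osub => y <= x < 2 ^ w
  | Oeq | Olt => 0 < w
  | _ => false
  end.

Definition nstep (i : instr) (g : nstate) : nstate :=
  let r := nreg g in
  match i with
  | Const d c => nset_reg g d (N.to_nat c)
  | Move d x => nset_reg g d (r x)
  | Un _ _ _ => g
  | Bin o d x y => nset_reg g d (nbinop o (r x) (r y))
  | Fetch d a => nset_reg g d (nmem g (r a))
  | Store a x => NState r (fun b => if b == r a then r x else nmem g b) (ntable g)
  | Insert t key x =>
      NState r (nmem g) (fun t' key' =>
        if (t' == r t) && (key' == r key) then Some (r x) else ntable g t' key')
  | Lookup d f t key =>
      nset_reg (nset_reg g d (odflt 0 (ntable g (r t) (r key)))) f
        (isSome (ntable g (r t) (r key)))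
  end.

Definition step_fits w (i : instr) (g : nstate) : bool :=
  match i with
  | Const _ c => N.to_nat c < 2 ^ w
  | Un _ _ _ => false
  | Bin o _ x y => binop_fits w o (nreg g x) (nreg g y)
  | _ => true
  end.

Lemma of_nat_edivn x y : 0 < y ->
  N.of_nat x = (N.of_nat y * N.of_nat (x %/ y) + N.of_nat (x %% y))%num /\
  (N.of_nat (x %% y) < N.of_nat y)%num.
Proof.
move=> y0; have := divn_eq x y; have := ltn_mod x y; rewrite y0.
move: (x %/ y) (x %% y) => q r; nia.
Qed.

Lemma of_nat_div x y : N.of_nat (x %/ y) = N.div (N.of_nat x) (N.of_nat y).
Proof.
case: y => [|y]; first by rewrite divn0; case: x.
by have [E lt] := @of_nat_edivn x y.+1 isT; apply: N.div_unique lt E.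
Qed.

Lemma of_nat_mod x y : N.of_nat (x %% y) = N.modulo (N.of_nat x) (N.of_nat y).
Proof.
case: y => [|y]; first by rewrite modn0; case: x.
by have [E lt] := @of_nat_edivn x y.+1 isT; apply: N.mod_unique lt E.
Qed.

Lemma wrap_of_nat w x : x < 2 ^ w -> Defs.wrap w (N.of_nat x) = N.of_nat x.
Proof. by move=> xw; rewrite /Defs.wrap of_nat_expn2 -of_nat_mod modn_small. Qed.

Lemma bool_fits w (b : bool) : 0 < w -> b < 2 ^ w.
Proof. by move=> w0; rewrite (leq_ltn_trans (leq_b1 b)) // (ltn_exp2l 0 w). Qed.

Lemma wrap_bool w (b : bool) : 0 < w -> Defs.wrap w (N_of_bool b) = N.of_nat b.
Proof.
move=> w0; have -> : N_of_bool b = N.of_nat b by case: b.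
by rewrite wrap_of_nat // bool_fits.
Qed.

Lemma eval_binop_of_nat w o x y : binop_fits w o x y ->
  eval_binop w o (N.of_nat x) (N.of_nat y) = N.of_nat (nbinop o x y).
Proof.
rewrite /eval_binop; case: o => //= fits.
- by rewrite -(wrap_of_nat fits) Nnat.Nat2N.inj_add.
- have [yx xw] := andP fits; rewrite -(wrap_of_nat (leq_ltn_trans (leq_subr y x) xw)).
  rewrite /Defs.wrap of_nat_expn2 -Nnat.Nat2N.inj_add -Nnat.Nat2N.inj_sub.
  by rewrite -!of_nat_mod -[Nat.add _ _]/(x + 2 ^ w) -[Nat.sub _ _]/(x + 2 ^ w - y) addnC
    -addnBA // modnDl.
- by rewrite -(wrap_of_nat fits) Nnat.Nat2N.inj_mul.
- by rewrite -of_nat_div wrap_of_nat.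
- by rewrite -of_nat_mod wrap_of_nat.
- by rewrite (_ : N.eqb _ _ = (x == y)) ?wrap_bool //; lia.
- by rewrite (_ : N.ltb _ _ = (x < y)) ?wrap_bool //; lia.
Qed.

Lemma represents_set_reg s g d v :
  represents s g -> represents (set_reg s d (N.of_nat v)) (nset_reg g d v).
Proof. by case=> hr hm ht; split=> // r /=; case: eqP. Qed.

Lemma represents_step w i s g :
  step_fits w i g -> represents s g -> represents (step w i s) (nstep i g).
Proof.
move=> fits S; have [hr hm ht] := S.
case: i fits => [d c|d x|//|o d x y|d a|a x|t key x|d f t key] /= fits.
- by rewrite -{1}(Nnat.N2Nat.id c) wrap_of_nat //; apply: represents_set_reg.
- by rewrite hr; apply: represents_set_reg.
- by rewrite !hr eval_binop_of_nat //; apply: represents_set_reg.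
- by rewrite hr hm; apply: represents_set_reg.
- by split=> // b /=; rewrite !hr (_ : N.eqb _ _ = (b == nreg g a)); [case: eqP|lia].
- split=> // t' key' /=; rewrite !hr.
  rewrite (_ : N.eqb _ _ = (t' == nreg g t)); last lia.
  by rewrite (_ : N.eqb _ _ = (key' == nreg g key)); [case: ifP|lia].
rewrite !hr ht; case: (ntable g _ _) => [v|] /=.
  by apply: (@represents_set_reg _ _ f 1); apply: represents_set_reg.
by apply: (@represents_set_reg _ _ f 0); apply: (@represents_set_reg _ _ d 0).
Qed.

(** * Timed correctness assertions *)

Definition runs w c (g : nstate) (time : nat) (Q : nstate -> Prop) : Prop :=
  forall s, represents s g -> exists T s',
    [/\ exec w unit_cost c s T s', T <= time & exists2 g', represents s' g' & Q g'].

Lemma runs_weaken w c g time time' (Q Q' : nstate -> Prop) :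
  runs w c g time Q -> time <= time' -> (forall g', Q g' -> Q' g') ->
  runs w c g time' Q'.
Proof.
move=> run_c tt' QQ' s /run_c[T [s' [e Tt [g' S q]]]]; exists T, s'; split=> //.
  exact: leq_trans Tt tt'.
by exists g' => //; apply: QQ'.
Qed.

Lemma runs_skip w g time (Q : nstate -> Prop) : Q g -> runs w Skip g time Q.
Proof. by move=> q s S; exists 0, s; split=> //; [constructor|exists g]. Qed.

Lemma runs_seq w c1 c2 g time1 time2 (Q1 Q : nstate -> Prop) :
  runs w c1 g time1 Q1 -> (forall g', Q1 g' -> runs w c2 g' time2 Q) ->
  runs w (Seq c1 c2) g (time1 + time2) Q.
Proof.
move=> run_c1 run_c2 s /run_c1[T1 [s1 [e1 h1 [g1 S1 /run_c2/(_ _ S1)[T2 [s2 [e2 h2 q]]]]]]].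
by exists (T1 + T2), s2; split=> //; [apply: exec_seq e1 e2|apply: leq_add].
Qed.

Lemma runs_if w x c1 c2 g time (Q : nstate -> Prop) :
  runs w (if nreg g x == 0 then c2 else c1) g time Q ->
  runs w (If x c1 c2) g time.+1 Q.
Proof.
move=> run_branch s S; have [T [s' [e h q]]] := run_branch _ S; exists T.+1, s'; split=> //.
case: S => hr _ _; rewrite -add1n; case: eqP e => test e.
  by apply: exec_if_false e; rewrite hr test.
by apply: exec_if_true e; rewrite hr; lia.
Qed.

Definition block (instrs : seq instr) : cmd := foldr (fun i => Seq (Do i)) Skip instrs.

Arguments block : simpl never.

Fixpoint block_fits w (instrs : seq instr) (g : nstate) : bool :=
  if instrs is i :: r then step_fits w i g && block_fits w r (nstep i g) else true.

Lemma runs_block w instrs g (Q : nstate -> Prop) : block_fits w instrs g ->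
  Q (foldl (fun g i => nstep i g) g instrs) -> runs w (block instrs) g (size instrs) Q.
Proof.
elim: instrs g => [|i r IH] g /=; first by move=> _; apply: runs_skip.
case/andP=> fits /IH post /post{}post; rewrite -add1n.
apply: (runs_seq (Q1 := eq (nstep i g))).
  move=> s S; exists 1, (step w i s); split=> //; first exact: (exec_do _ unit_cost).
  by exists (nstep i g) => //; apply: represents_step.
by move=> _ <-.
Qed.

Lemma runs_while w x c (Inv : nat -> nstate -> Prop) (time : nat -> nat) L total g :
  \sum_(j < L) (time j).+1 < total ->
  (forall j g, j <= L -> Inv j g -> (nreg g x != 0) = (j < L)) ->
  (forall j g, j < L -> Inv j g -> runs w c g (time j) (Inv j.+1)) ->
  Inv 0 g -> runs w (While x c) g total (Inv L).
Proof.
move=> tot test body I0; apply: (@runs_weaken _ _ _ _ _ (Inv L) _ _ tot) => //.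
suff run_from d j g' : j + d = L -> Inv j g' ->
    runs w (While x c) g' (\sum_(j <= i < L) (time i).+1).+1 (Inv L).
  by rewrite -(big_mkord xpredT (fun j => (time j).+1)); apply: (run_from L).
elim: d j g' => [|d IH] j g'.
  rewrite addn0 => -> I s S; exists 1, s; split=> //; last by exists g'.
  apply: exec_while_false; case: S => -> _ _.
  by have := test _ _ (leqnn L) I; rewrite ltnn => /negbFE/eqP->.
rewrite addnS => jL I; have jltL : j < L by lia.
move=> s S; have [T1 [s1 [e1 h1 [g1 S1 I1]]]] := body _ _ jltL I _ S.
have [T2 [s2 [e2 h2 q]]] := IH j.+1 g1 jL I1 _ S1.
exists (1 + T1 + T2), s2; split=> //; last by rewrite big_ltn //; lia.
apply: exec_while_true e1 e2; case: S => -> _ _.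
by have := test _ _ (ltnW jltL) I; rewrite jltL; lia.
Qed.

Fixpoint written (c : cmd) : seq nat :=
  match c with
  | Skip => [::]
  | Do i =>
      match i with
      | Const d _ | Move d _ | Un _ d _ | Bin _ d _ _ | Fetch d _ => [:: d]
      | Store _ _ | Insert _ _ _ => [::]
      | Lookup d f _ _ => [:: d; f]
      end
  | Seq c1 c2 | If _ c1 c2 => written c1 ++ written c2
  | While _ c => written c
  end.

Lemma exec_frame w cost c s T s' r :
  exec w cost c s T s' -> r \notin written c -> reg s' r = reg s r.
Proof.
elim=> {c s T s'} //=.
- case=> [d c|d x|o d x|o d x y|d a|a x|t key x|d f t key] s //=;
    rewrite !inE ?negb_or; try by move=> /negPf->.
  by case/andP=> /negPf rd /negPf rf; case: (table s _ _) => [v|] /=; rewrite rd rf.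
- by move=> c1 c2 s1 s2 s3 T1 T2 _ IH1 _ IH2; rewrite mem_cat negb_or => /andP[/IH1<- /IH2].
- by move=> x c1 c2 s T s' _ _ IH; rewrite mem_cat negb_or => /andP[/IH].
- by move=> x c1 c2 s T s' _ _ IH; rewrite mem_cat negb_or => /andP[_ /IH].
by move=> x c s1 s2 s3 T1 T2 _ _ IH1 _ IH2 rc; rewrite IH2 // IH1.
Qed.

Definition holds (A : seq (nat * nat)) (g : nstate) : bool :=
  all (fun p => nreg g p.1 == p.2) A.

Fixpoint value_in (A : seq (nat * nat)) (r : nat) : nat :=
  if A is (r', v) :: A' then if r == r' then v else value_in A' r else 0.

Lemma holdsE A g r : holds A g -> r \in unzip1 A -> nreg g r = value_in A r.
Proof.
elim: A => //= -[r' v] A IH /andP[/= /eqP gv /IH{}IH].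
by rewrite inE; case: eqP => [-> //|_ /IH].
Qed.

Lemma holds_cat A A' g : holds (A ++ A') g = holds A g && holds A' g.
Proof. exact: all_cat. Qed.

Definition unwritten c (A : seq (nat * nat)) := ~~ has (mem (written c)) (unzip1 A).

Lemma runs_frame w c g time (Q : nstate -> Prop) A :
  unwritten c A -> holds A g -> runs w c g time Q ->
  runs w c g time (fun g' => holds A g' /\ Q g').
Proof.
move=> cA gA run_c s S; have [T [s' [e Tt [g' S' q]]]] := run_c s S.
exists T, s'; split=> //; exists g' => //; split=> //.
apply/allP => p pA; rewrite -(eqP (allP gA p pA)); apply/eqP/Nnat.Nat2N.inj.
case: S S' => hr _ _ [hr' _ _]; rewrite -hr -hr'; apply: exec_frame e _.
by move/hasPn: cA; apply; apply: map_f.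
Qed.

Lemma runs_while_frame w x c A (Inv : nat -> nstate -> Prop) (time : nat -> nat) L total g :
  unwritten c A -> holds A g -> \sum_(j < L) (time j).+1 < total ->
  (forall j g, j <= L -> Inv j g -> (nreg g x != 0) = (j < L)) ->
  (forall j g, j < L -> holds A g -> Inv j g -> runs w c g (time j) (Inv j.+1)) ->
  Inv 0 g -> runs w (While x c) g total (fun g' => holds A g' /\ Inv L g').
Proof.
move=> cA gA tot test body I0.
apply: (@runs_while _ _ _ (fun j g => holds A g /\ Inv j g) time) => // [j g' jL [_]|].
  exact: test.
by move=> j g' jL [g'A I]; apply: runs_frame => //; apply: body.
Qed.

(** * The program *)

Local Notation r_n := 0 (only parsing).
Local Notation r_k := 1 (only parsing).
Local Notation r_one := 2 (only parsing).
Local Notation r_zero := 3 (only parsing).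
Local Notation r_bound := 4 (only parsing).
Local Notation r_base := 5 (only parsing).
Local Notation r_top := 6 (only parsing).
Local Notation r_level := 7 (only parsing).
Local Notation r_next_level := 8 (only parsing).
Local Notation r_mark := 9 (only parsing).
Local Notation r_rank := 10 (only parsing).
Local Notation r_index := 11 (only parsing).
Local Notation r_unseen := 12 (only parsing).
Local Notation r_scanning := 13 (only parsing).
Local Notation r_head := 14 (only parsing).
Local Notation r_segment_end := 15 (only parsing).
Local Notation r_tail := 16 (only parsing).
Local Notation r_letter := 17 (only parsing).
Local Notation r_length := 18 (only parsing).
Local Notation r_extending := 19 (only parsing).
Local Notation r_positions := 20 (only parsing).
Local Notation r_popping := 21 (only parsing).
Local Notation r_value := 22 (only parsing).
Local Notation r_prefix := 23 (only parsing).
Local Notation r_suffix := 24 (only parsing).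
Local Notation r_weight := 25 (only parsing).
Local Notation r_marks := 26 (only parsing).
Local Notation r_position := 27 (only parsing).
Local Notation r_inserting := 28 (only parsing).
Local Notation r_shifted := 29 (only parsing).
Local Notation r_child := 30 (only parsing).
Local Notation r_count := 31 (only parsing).
Local Notation r_agree := 32 (only parsing).
Local Notation r_marked := 33 (only parsing).
Local Notation r_digit := 34 (only parsing).
Local Notation r_scratch := 35 (only parsing).

Local Notation "c1 ;; c2" := (Seq c1 c2) (at level 60, right associativity).

Definition compute_child : cmd :=
  block [:: Bin Omul r_shifted r_suffix r_base; Bin Oadd r_child r_letter r_shifted;
    Bin Omul r_child r_weight r_child; Bin Oadd r_child r_prefix r_child;
    Move r_count r_value; Bin Oeq r_agree r_marks r_rank].

Definition add_marked_value : cmd :=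
  block [:: Bin Omul r_marked r_weight r_shifted; Bin Oadd r_marked r_prefix r_marked;
    Lookup r_marked r_scratch r_next_level r_marked; Bin Oadd r_count r_count r_marked].

Definition record_child : cmd :=
  block [:: Store r_tail r_child; Insert r_level r_child r_count;
    Bin Oadd r_tail r_tail r_one].

(* The factor [r_inserting] of [r_weight] avoids an overflow after the last position. *)
Definition advance : cmd :=
  block [:: Bin Oadd r_position r_position r_one;
    Bin Olt r_inserting r_position r_positions;
    Bin Omod r_digit r_suffix r_base; Bin Odiv r_suffix r_suffix r_base;
    Bin Omul r_scratch r_weight r_digit; Bin Oadd r_prefix r_prefix r_scratch;
    Bin Omul r_scratch r_base r_inserting; Bin Omul r_weight r_weight r_scratch;
    Bin Oeq r_digit r_digit r_zero; Bin Omul r_digit r_digit r_inserting;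
    Bin Oadd r_marks r_marks r_digit].

Definition insertion_body : cmd :=
  compute_child ;; If r_agree add_marked_value Skip ;; record_child ;; advance.

Definition word_body : cmd :=
  block [:: Fetch r_suffix r_head; Lookup r_value r_scratch r_level r_suffix;
    Const r_prefix 0; Const r_weight 1; Const r_marks 0; Const r_position 0;
    Const r_inserting 1] ;;
  While r_inserting insertion_body ;;
  block [:: Bin Oadd r_head r_head r_one; Bin Olt r_popping r_head r_segment_end].

Definition length_body : cmd :=
  block [:: Bin Oadd r_positions r_length r_one; Const r_popping 1] ;;
  While r_popping word_body ;;
  block [:: Move r_segment_end r_tail; Bin Oadd r_letter r_letter r_one;
    Bin Oadd r_length r_length r_one; Bin Olt r_extending r_length r_n].

Definition scan_body : cmd :=
  block [:: Fetch r_digit r_index; Bin Olt r_scratch r_mark r_digit;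
    Bin Omul r_scratch r_scratch r_unseen; Bin Oadd r_rank r_rank r_scratch;
    Bin Oeq r_scratch r_mark r_digit; Bin Oeq r_scratch r_scratch r_zero;
    Bin Omul r_unseen r_scratch r_unseen; Bin Oadd r_index r_index r_one;
    Bin Olt r_scanning r_index r_top].

Definition start_scan : cmd :=
  block [:: Bin Osub r_level r_next_level r_one; Bin Osub r_mark r_k r_level;
    Const r_rank 0; Const r_index 0; Const r_unseen 1;
    Bin Olt r_scanning r_index r_top].

Definition start_queue : cmd :=
  block [:: Store r_n r_zero; Bin Oeq r_scratch r_level r_k;
    Insert r_level r_zero r_scratch; Move r_head r_n; Move r_segment_end r_bound;
    Move r_tail r_bound; Const r_letter 1; Move r_length r_level;
    Bin Olt r_extending r_length r_n].

Definition open_level : cmd :=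
  start_scan ;; While r_scanning scan_body ;; start_queue.

Definition level_body : cmd :=
  open_level ;;
  While r_extending length_body ;; block [:: Move r_next_level r_level].

Definition double_base : cmd :=
  block [:: Bin Oadd r_base r_base r_base; Bin Olt r_scratch r_base r_bound].

Definition start_levels : cmd :=
  block [:: Move r_top r_n; Bin Olt r_scratch r_k r_bound] ;;
  If r_scratch (block [:: Move r_top r_k]) Skip ;;
  block [:: Bin Oadd r_next_level r_top r_one].

Definition count_hits_long : cmd :=
  block [:: Bin Oadd r_bound r_n r_one; Const r_base 1;
    Bin Olt r_scratch r_base r_bound] ;;
  While r_scratch double_base ;; start_levels ;; While r_next_level level_body.

(* A word of length at most 1 is its own packing. *)
Definition count_hits_short : cmd :=
  block [:: Bin Olt r_scratch r_n r_k; Bin Oeq r_scratch r_scratch r_zero;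
    Insert r_zero r_n r_scratch].

Definition count_hits : cmd :=
  block [:: Const r_one 1; Bin Olt r_scratch r_one r_n] ;;
  If r_scratch count_hits_long count_hits_short.

(** * One level *)

Section Level.

Variables (n B i : nat) (f : seq nat -> nat).
Variables (mem0 : nat -> nat) (table0 : nat -> nat -> option nat).
Hypothesis lt_n_B : n < B.
Hypothesis i_le_n : i <= n.

Let level_words := shorter_words i (n - i).+1.

Lemma level_wordP x :
  reflect (exists2 m, i + m <= n & marked_word i m x) (x \in level_words).
Proof.
apply: (iffP (mem_shorter_words _ _ _)) => -[m mn xm]; exists m => //; lia.
Qed.

Lemma level_word_lt x : x \in level_words -> all (gtn B) x.
Proof. by case/level_wordP=> m mn xm; apply: marked_word_lt xm _; lia. Qed.

Lemma level_word_inj : {in level_words &, injective (radix B)}.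
Proof.
move=> x y xl yl; apply: radix_inj; rewrite ?level_word_lt //.
case/level_wordP: xl => m _ /marks_marked_word->.
by case/level_wordP: yl => m' _ /marks_marked_word->.
Qed.

(* [mem0] and [table0] are the memory and the tables at the start of the level. *)
Definition queue_holds (Q : seq (seq nat)) (g : nstate) : Prop :=
  [/\ {subset Q <= level_words},
      forall a, a < n -> nmem g a = mem0 a,
      forall j, j < size Q -> nmem g (n + j) = radix B (nth [::] Q j),
      {in Q, forall x, ntable g i (radix B x) = Some (f x)} &
      forall j key, j != i -> ntable g j key = table0 j key].

Lemma queue_holds_rcons Q x g g' :
  queue_holds Q g -> x \in level_words ->
  (forall a, nmem g' a = if a == n + size Q then radix B x else nmem g a) ->
  (forall j key, ntable g' j key =
     if (j == i) && (key == radix B x) then Some (f x) else ntable g j key) ->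
  queue_holds (rcons Q x) g'.
Proof.
case=> Ql pattern cells values others xl memE tableE; split.
- by move=> z; rewrite mem_rcons inE => /predU1P[->|/Ql].
- by move=> a an; rewrite memE ltn_eqF ?pattern // ltn_addr.
- move=> j; rewrite size_rcons ltnS nth_rcons memE eqn_add2l => jQ.
  by case: ltngtP jQ => // jQ _; rewrite cells.
- move=> z; rewrite mem_rcons inE tableE eqxx /= => /predU1P[->|zQ].
    by rewrite eqxx.
  case: eqP => [zx|_]; last exact: values.
  by rewrite (level_word_inj (Ql _ zQ) xl zx).
by move=> j key ji; rewrite tableE (negPf ji) others.
Qed.

Variables (w rank : nat).
Hypothesis w_gt0 : 0 < w.
Hypothesis B_exp : B ^ n <= 2 ^ w.
Hypothesis queue_fits : n + level_size i n < 2 ^ w.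
Hypothesis f_lt : forall x, size x <= n -> f x < 2 ^ w.
Hypothesis f_insert : forall m y l, marked_word i m y -> i + m < n -> l <= i + m ->
  f (insert_at l m.+1 y) =
  f y + (marks (take l y) == rank) * odflt 0 (table0 i.+1 (radix B (insert_at l 0 y))).

Lemma n_succ_fits : n.+1 < 2 ^ w.
Proof. by have := level_size_gt0 i n; lia. Qed.

Lemma radix_fits x : all (gtn B) x -> size x <= n -> radix B x < 2 ^ w.
Proof.
move=> xB xn; apply: leq_trans B_exp; apply: leq_trans (radix_lt xB) _.
by rewrite leq_pexp2l //; lia.
Qed.

Section Insertions.

Variables (Q : seq (seq nat)) (m : nat) (y : seq nat).
Hypothesis ym : marked_word i m y.
Hypothesis im_lt_n : i + m < n.
Hypothesis Q_fits : n + size Q + (i + m).+1 < 2 ^ w.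

Definition insertion_env :=
  [:: (r_one, 1); (r_zero, 0); (r_base, B); (r_level, i); (r_next_level, i.+1);
      (r_rank, rank); (r_letter, m.+1); (r_positions, (i + m).+1); (r_value, f y)].

Definition position_regs l :=
  [:: (r_inserting, nat_of_bool (l < (i + m).+1)); (r_prefix, radix B (take l y));
      (r_suffix, radix B (drop l y)); (r_weight, B ^ l * (l <= i + m));
      (r_marks, marks (take l y)); (r_position, l)].

Definition insertion_regs l := (r_tail, n + size Q + l) :: position_regs l.

Definition inserted l := Q ++ [seq insert_at j m.+1 y | j <- iota 0 l].

Definition child_regs l v :=
  [:: (r_shifted, radix B (drop l y) * B); (r_child, radix B (insert_at l m.+1 y));
      (r_count, v)].

Definition agree_reg l := (r_agree, nat_of_bool (marks (take l y) == rank)).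

Let size_y : size y = i + m := size_marked_word ym.

Lemma insert_at_fits l c : c <= m.+1 -> radix B (insert_at l c y) < 2 ^ w.
Proof.
move=> cm; apply: radix_fits; last by rewrite size_insert_at size_y.
rewrite (perm_all _ (perm_insert_at l c y)) /=; apply/andP; split; first by lia.
by apply: marked_word_lt ym _; lia.
Qed.

Lemma insert_at_terms_fit l c : l <= i + m -> c <= m.+1 ->
  let shifted := radix B (drop l y) * B in
  [/\ shifted < 2 ^ w, c + shifted < 2 ^ w, B ^ l * (c + shifted) < 2 ^ w &
      radix B (take l y) + B ^ l * (c + shifted) < 2 ^ w].
Proof.
move=> li /(insert_at_fits l); rewrite radix_insert_at ?size_y //.
set shifted := _ * B => /= fits; have Bl : 0 < B ^ l by rewrite expn_gt0; lia.
have sum_le : c + shifted <= B ^ l * (c + shifted) by rewrite leq_pmull.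
by split=> //; lia.
Qed.

Lemma compute_child_runs l g : l <= i + m ->
  holds (insertion_regs l ++ insertion_env) g -> queue_holds (inserted l) g ->
  runs w compute_child g 6 (fun g' =>
    holds (agree_reg l :: child_regs l (f y)) g' /\ queue_holds (inserted l) g').
Proof.
move=> li known queue_g.
have [shifted_fits sum_fits product_fits child_fits] :=
  insert_at_terms_fit li (leqnn m.+1).
apply: runs_block; rewrite /= !(holdsE known) //= li !muln1.
  by rewrite shifted_fits sum_fits product_fits child_fits w_gt0.
by rewrite -radix_insert_at ?size_y // !eqxx.
Qed.

Lemma add_marked_value_runs l g : l <= i + m ->
  holds (agree_reg l :: child_regs l (f y) ++ insertion_regs l ++ insertion_env) g ->
  queue_holds (inserted l) g ->
  runs w (If r_agree add_marked_value Skip) g 5 (fun g' =>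
    holds (child_regs l (f (insert_at l m.+1 y))) g' /\ queue_holds (inserted l) g').
Proof.
move=> li known queue_g; have fE := f_insert ym im_lt_n li.
have fits : f (insert_at l m.+1 y) < 2 ^ w.
  by apply: f_lt; rewrite size_insert_at size_y.
apply: runs_if; rewrite (holdsE known) //=; move: fE fits.
case: eqP => ranks_agree ->; last first.
  rewrite mul0n addn0 => _; apply: runs_skip; split=> //.
  by move: known; rewrite -cat_cons holds_cat => /andP[/andP[]].
rewrite mul1n => fits; have := insert_at_terms_fit li (leq0n m.+1).
have markedE : radix B (take l y) + B ^ l * (radix B (drop l y) * B) =
    radix B (insert_at l 0 y) by rewrite radix_insert_at ?size_y.
have [_ _ _ _ others] := queue_g.
rewrite /= add0n markedE => -[_ _ product_fits marked_fits]; apply: runs_block;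
  rewrite /= !(holdsE known) //= li !muln1 markedE others ?neq_ltn ?ltnSn ?orbT //.
  by rewrite product_fits marked_fits fits.
by rewrite !eqxx.
Qed.

Lemma advance_terms_fit l : l <= i + m ->
  [/\ nth 0 y l < 2 ^ w, radix B (drop l.+1 y) < 2 ^ w, radix B (take l.+1 y) < 2 ^ w,
      B ^ l.+1 * (l < i + m) < 2 ^ w & marks (take l.+1 y) < 2 ^ w].
Proof.
move=> li; have yB : all (gtn B) y by apply: marked_word_lt ym _; lia.
have BW : B <= 2 ^ w by apply: leq_trans B_exp; rewrite -{1}[B]expn1 leq_pexp2l //; lia.
split.
- case: (ltnP l (size y)) => ly; last by rewrite nth_default // expn_gt0.
  by apply: leq_trans BW; apply: (allP yB); apply: mem_nth.
- apply: radix_fits; first by apply/allP => a /mem_drop/(allP yB).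
  by rewrite size_drop size_y; lia.
- apply: radix_fits; first by apply/allP => a /mem_take/(allP yB).
  by rewrite size_take_min size_y; lia.
- case: (ltnP l (i + m)) => lim; last by rewrite muln0 expn_gt0.
  by rewrite muln1; apply: leq_trans B_exp; rewrite ltn_exp2l; lia.
by have := count_size (eq_op 0) (take l.+1 y); rewrite size_take_min -/(marks _); lia.
Qed.

Lemma insertedS l : inserted l.+1 = rcons (inserted l) (insert_at l m.+1 y).
Proof. by rewrite /inserted -(addn1 l) iotaD map_cat catA cats1. Qed.

Lemma size_inserted l : size (inserted l) = size Q + l.
Proof. by rewrite size_cat size_map size_iota. Qed.

Lemma record_child_runs l g : l <= i + m ->
  holds (child_regs l (f (insert_at l m.+1 y)) ++ insertion_regs l ++ insertion_env) g ->
  queue_holds (inserted l) g ->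
  runs w record_child g 3 (fun g' =>
    holds [:: (r_tail, n + size Q + l.+1)] g' /\ queue_holds (inserted l.+1) g').
Proof.
move=> li known queue_g; apply: runs_block; rewrite /= !(holdsE known) //= addn1.
  by rewrite andbT; lia.
rewrite addnS eqxx insertedS; split=> //; apply: (queue_holds_rcons queue_g) => //=.
  by apply/level_wordP; exists m.+1; [rewrite addnS|apply: marked_word_insert].
by move=> a; rewrite size_inserted addnA.
Qed.

Lemma advance_runs l g : l <= i + m -> holds (position_regs l ++ insertion_env) g ->
  queue_holds (inserted l.+1) g ->
  runs w advance g 11 (fun g' =>
    holds (position_regs l.+1) g' /\ queue_holds (inserted l.+1) g').
Proof.
move=> li known queue_g.
have [letter_fits suffix_fits prefix_fits weight_fits marks_fit] := advance_terms_fit li.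
have yB : all (gtn B) y by apply: marked_word_lt ym _; lia.
have B0 : 0 < B by lia.
have digit_fits : B ^ l * nth 0 y l < 2 ^ w.
  by apply: leq_ltn_trans prefix_fits; rewrite radix_takeS leq_addl.
have base_fits : B * (l < i + m) < 2 ^ w.
  apply: leq_ltn_trans weight_fits.
  by rewrite leq_mul2r expnS leq_pmulr ?orbT // expn_gt0 B0.
have position_fits : l.+1 < 2 ^ w by lia.
rewrite marks_takeS size_y in marks_fit; rewrite radix_takeS in prefix_fits.
apply: runs_block; rewrite /= !(holdsE known) //= li muln1 !addn1 ltnS
  radix_drop_mod // radix_drop_div // mulnA -expnSr.
  by rewrite w_gt0 position_fits letter_fits suffix_fits prefix_fits weight_fits marks_fit
    digit_fits base_fits mulnb bool_fits.
by rewrite radix_takeS marks_takeS size_y !eqxx.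
Qed.

Lemma insertion_body_runs l g : l <= i + m -> holds insertion_env g ->
  holds (insertion_regs l) g /\ queue_holds (inserted l) g ->
  runs w insertion_body g 25 (fun g' =>
    holds (insertion_regs l.+1) g' /\ queue_holds (inserted l.+1) g').
Proof.
move=> li env_g [regs_g queue_g].
have known : holds (insertion_regs l ++ insertion_env) g by rewrite holds_cat regs_g.
apply: (runs_seq (runs_frame _ known (compute_child_runs li known queue_g))) => //.
move=> g1 [known1 [child1 queue1]].
have {}child1 : holds (agree_reg l :: child_regs l (f y) ++ insertion_regs l ++
    insertion_env) g1 by rewrite -cat_cons holds_cat child1.
apply: (runs_seq (runs_frame _ known1 (add_marked_value_runs li child1 queue1))) => //.
move=> g2 [known2 [child2 queue2]].
have position2 : holds (position_regs l ++ insertion_env) g2 by case/andP: known2.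
have {}child2 : holds (child_regs l (f (insert_at l m.+1 y)) ++ insertion_regs l ++
    insertion_env) g2 by rewrite holds_cat child2.
apply: (runs_seq (runs_frame _ position2 (record_child_runs li child2 queue2))) => //.
move=> g3 [position3 [tail3 queue3]].
apply: (runs_weaken (runs_frame _ tail3 (advance_runs li position3 queue3))) => // g4.
case=> tail4 [position4 queue4]; split=> //.
by rewrite /insertion_regs -cat1s holds_cat tail4.
Qed.

Lemma insertion_loop_runs g : holds insertion_env g ->
  holds (insertion_regs 0) g -> queue_holds Q g ->
  runs w (While r_inserting insertion_body) g (26 * (i + m).+2) (fun g' =>
    holds insertion_env g' /\
    (holds (insertion_regs (i + m).+1) g' /\ queue_holds (Q ++ insertions m.+1 y) g')).
Proof.
move=> env_g regs0 queue0; rewrite /insertions size_y.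
apply: (@runs_while_frame _ _ _ _ (fun l g =>
  holds (insertion_regs l) g /\ queue_holds (inserted l) g) (fun=> 25)) => //.
- by rewrite sum_nat_const card_ord; lia.
- by move=> l g' _ [known _]; rewrite (holdsE known) //=; case: ltnP.
- by move=> l g' li env_g'; apply: insertion_body_runs.
by rewrite /inserted cats0.
Qed.

End Insertions.

Section Words.

Variable m : nat.
Hypothesis im_lt_n : i + m < n.

Definition word_env :=
  [:: (r_one, 1); (r_zero, 0); (r_base, B); (r_level, i); (r_next_level, i.+1);
      (r_rank, rank); (r_letter, m.+1); (r_positions, (i + m).+1);
      (r_segment_end, n + size (shorter_words i m.+1))].

Definition queued j :=
  shorter_words i m.+1 ++
    flatten [seq insertions m.+1 y | y <- take j (marked_words i m)].

Definition word_regs j :=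
  [:: (r_popping, nat_of_bool (j < size (marked_words i m)));
      (r_head, n + size (shorter_words i m) + j); (r_tail, n + size (queued j))].

Lemma queued_all : queued (size (marked_words i m)) = shorter_words i m.+2.
Proof. by rewrite /queued take_size. Qed.

Lemma queuedS j : j < size (marked_words i m) ->
  queued j.+1 = queued j ++ insertions m.+1 (nth [::] (marked_words i m) j).
Proof.
by move=> jm; rewrite /queued (take_nth [::] jm) map_rcons flatten_rcons catA.
Qed.

Lemma size_queued j : j <= size (marked_words i m) ->
  size (queued j) = size (shorter_words i m.+1) + j * (i + m).+1.
Proof.
move=> jm; rewrite size_cat (@size_flatten_insertions i m) ?size_takel //.
by apply/allP => y /mem_take/(allP (all_marked_words i m)).
Qed.

Lemma queued_fits j : j < size (marked_words i m) ->
  n + size (queued j) + (i + m).+1 < 2 ^ w.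
Proof.
move=> jm; apply: leq_ltn_trans queue_fits; rewrite -addnA leq_add2l.
apply: leq_trans (leq_size_shorter_words i (_ : m.+2 <= (n - i).+1)); last by lia.
rewrite -queued_all !size_queued // ?(ltnW jm) // -addnA leq_add2l addnC -mulSn.
by rewrite leq_mul2r jm orbT.
Qed.

Lemma head_fits j : j < size (marked_words i m) ->
  (n + size (shorter_words i m) + j).+1 < 2 ^ w.
Proof.
move=> jm; have := queued_fits jm; rewrite size_queued ?(ltnW jm) //= size_cat; lia.
Qed.

Lemma word_body_runs j g : j < size (marked_words i m) -> holds word_env g ->
  holds (word_regs j) g /\ queue_holds (queued j) g ->
  runs w word_body g (7 + (26 * (i + m).+2 + 2)) (fun g' =>
    holds (word_regs j.+1) g' /\ queue_holds (queued j.+1) g').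
Proof.
move=> jm env_g [regs_g queue_g]; set y := nth [::] (marked_words i m) j.
have known : holds (word_regs j ++ word_env) g by rewrite holds_cat regs_g.
have ym : marked_word i m y by rewrite -mem_marked_words mem_nth.
have yQ : y \in queued j by rewrite !mem_cat mem_marked_words ym orbT.
have yE : nmem g (n + size (shorter_words i m) + j) = radix B y.
  have [_ _ cells _ _] := queue_g; rewrite -addnA cells.
    by rewrite /queued -catA nth_cat ltnNge leq_addr /= addKn nth_cat jm.
  by rewrite /queued /= !size_cat; lia.
have fE : ntable g i (radix B y) = Some (f y) by case: queue_g => _ _ _ ->.
have fits := queued_fits jm; have one_fits : 1 < 2 ^ w := bool_fits true w_gt0.
apply: (runs_seq (Q1 := fun g1 => holds
  ((r_head, n + size (shorter_words i m) + j) :: word_env) g1 /\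
  (holds (insertion_env m y) g1 /\
  (holds (insertion_regs (queued j) m y 0) g1 /\ queue_holds (queued j) g1)))).
  apply: runs_block; first by rewrite /= one_fits expn_gt0.
  by rewrite /= !(holdsE known) //= yE fE take0 drop0 addn0 !eqxx.
move=> g1 [known1 [env1 [regs1 queue1]]].
have loop := insertion_loop_runs ym im_lt_n fits env1 regs1 queue1.
apply: (runs_seq (runs_frame _ known1 loop)) => //.
move=> g2 [known2 [_ [regs2 queue2]]].
have {}known2 : holds (insertion_regs (queued j) m y (i + m).+1 ++
    (r_head, n + size (shorter_words i m) + j) :: word_env) g2.
  by rewrite holds_cat regs2.
rewrite queuedS //; apply: runs_block; rewrite /= !(holdsE known2) //= addn1.
  by rewrite w_gt0 head_fits.
rewrite -addnS queuedS // (size_cat (queued j)) size_map size_iota.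
by rewrite (size_marked_word ym) addnA size_cat addnA ltn_add2l !eqxx.
Qed.

Lemma word_loop_runs g : holds word_env g -> holds (word_regs 0) g ->
  queue_holds (shorter_words i m.+1) g ->
  runs w (While r_popping word_body) g
    (36 * size (marked_words i m.+1) + 36 * size (marked_words i m)).+1 (fun g' =>
    holds word_env g' /\
    (holds (word_regs (size (marked_words i m))) g' /\
     queue_holds (shorter_words i m.+2) g')).
Proof.
move=> env_g regs0 queue0; rewrite -queued_all.
apply: (@runs_while_frame _ _ _ _ (fun j g =>
  holds (word_regs j) g /\ queue_holds (queued j) g)
  (fun=> 7 + (26 * (i + m).+2 + 2))) => //.
- by rewrite sum_nat_const card_ord size_marked_wordsS; nia.
- by move=> j g' _ [known _]; rewrite (holdsE known) //=; case: ltnP.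
- by move=> j g' jm env_g'; apply: word_body_runs.
by rewrite /queued take0 cats0.
Qed.

End Words.

Definition length_env :=
  [:: (r_n, n); (r_one, 1); (r_zero, 0); (r_base, B); (r_level, i);
      (r_next_level, i.+1); (r_rank, rank)].

Definition length_regs d :=
  [:: (r_extending, nat_of_bool (i + d < n));
      (r_head, n + size (shorter_words i d));
      (r_segment_end, n + size (shorter_words i d.+1));
      (r_tail, n + size (shorter_words i d.+1)); (r_letter, d.+1); (r_length, i + d)].

Definition length_time d :=
  2 + ((36 * size (marked_words i d.+1) + 36 * size (marked_words i d)).+1 + 4).

Lemma length_body_runs d g : i + d < n -> holds length_env g ->
  holds (length_regs d) g /\ queue_holds (shorter_words i d.+1) g ->
  runs w length_body g (length_time d) (fun g' =>
    holds (length_regs d.+1) g' /\ queue_holds (shorter_words i d.+2) g').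
Proof.
move=> idn env_g [regs_g queue_g]; have known : holds (length_regs d ++ length_env) g.
  by rewrite holds_cat regs_g.
have [letter_fits length_fits] : d.+2 < 2 ^ w /\ (i + d).+1 < 2 ^ w.
  by have := n_succ_fits; lia.
apply: (runs_seq (Q1 := fun g1 =>
  holds ((r_length, i + d) :: length_env) g1 /\
  (holds (word_env d) g1 /\
  (holds (word_regs d 0) g1 /\ queue_holds (shorter_words i d.+1) g1)))).
  apply: runs_block; rewrite /= !(holdsE known) //= addn1.
    by rewrite length_fits (bool_fits true w_gt0).
  rewrite size_marked_words_gt0 addn0 !eqxx.
  by rewrite /queued take0 cats0 eqxx.
move=> g1 [known1 [env1 [regs1 queue1]]].
apply: runs_seq (runs_frame _ known1 (word_loop_runs idn env1 regs1 queue1)) _ => //.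
move=> g2 [known2 [env2 [regs2 queue2]]].
have {}known2 : holds (word_regs d (size (marked_words i d)) ++
    (r_length, i + d) :: length_env ++ word_env d) g2.
  by rewrite holds_cat regs2 -cat_cons holds_cat known2.
apply: runs_block; rewrite /= !(holdsE known2) //= !addn1.
  by rewrite w_gt0 letter_fits length_fits.
by rewrite queued_all addnS -addnA -size_cat !eqxx.
Qed.

Lemma length_loop_time : \sum_(d < n - i) (length_time d).+1 < 80 * level_size i n.
Proof.
rewrite /level_size size_shorter_words.
apply: (@leq_ltn_trans (\sum_(d < n - i)
    (36 * size (marked_words i d.+1) + 44 * size (marked_words i d)))).
  apply: leq_sum => d _; have := size_marked_words_gt0 i d; rewrite /length_time; lia.
rewrite big_split -!big_distrr -[80]/(36 + 44) mulnDl /= -addSn.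
apply: leq_add; rewrite ?ltn_mul2l ?leq_mul2l /=.
  by rewrite big_ord_recl -[ltnLHS]add0n ltn_add2r size_marked_words_gt0.
by rewrite big_ord_recr /= leq_addr.
Qed.

Lemma length_loop_runs g : holds length_env g -> holds (length_regs 0) g ->
  queue_holds [:: nseq i 0] g ->
  runs w (While r_extending length_body) g (80 * level_size i n) (fun g' =>
    holds length_env g' /\ queue_holds level_words g').
Proof.
move=> env_g regs0 queue0.
apply: (@runs_weaken _ _ _ (80 * level_size i n) _ (fun g' => holds length_env g' /\
  (holds (length_regs (n - i)) g' /\ queue_holds (shorter_words i (n - i).+1) g'))) => //.
  apply: (@runs_while_frame _ _ _ _ (fun d g =>
    holds (length_regs d) g /\ queue_holds (shorter_words i d.+1) g)
    length_time) => //.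
  - exact: length_loop_time.
  - by move=> d g' _ [known _]; rewrite (holdsE known) //= -ltn_subRL; case: ltnP.
  - by move=> d g' dn env_g'; apply: length_body_runs; lia.
by move=> g' [env_g' [_ queue_g]].
Qed.

End Level.

(** * All levels *)

Section AllLevels.

Variables (w n k : nat) (P : seq nat).
Hypothesis P_perm : perm_eq P (iota 1 k).
Hypothesis n_gt1 : 1 < n.
Hypothesis w_large : n * letter_bits n <= w.
Hypothesis k_fits : k < 2 ^ w.

Let B := 2 ^ letter_bits n.
Let K := minn k n.

Lemma letter_bits_gt1 : 1 < letter_bits n.
Proof. by rewrite /letter_bits ltnS trunc_log_gt0. Qed.

Lemma n_lt_w : n < w.
Proof. by apply: leq_trans w_large; have := letter_bits_gt1; nia. Qed.

Lemma n_lt_base : n < B.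
Proof. exact: trunc_log_ltn. Qed.

Lemma base_exp_fits : B ^ n <= 2 ^ w.
Proof. by rewrite -expnM mulnC leq_exp2l. Qed.

Lemma queues_fit : n + 2 * n`! < 2 ^ w.
Proof.
apply: leq_trans base_exp_fits; apply: (@leq_trans (n.+1 ^ n)); last first.
  by rewrite leq_exp2r ?n_lt_base //; lia.
apply: leq_ltn_trans (fact_lt_exp n_gt1); rewrite factS [n.+1 * _]mulSn.
by apply: leq_add; [exact: fact_geq|rewrite leq_mul2r n_gt1 orbT].
Qed.

Lemma n_succ2_fits : n.+2 < 2 ^ w.
Proof. by apply: leq_ltn_trans queues_fit; have := fact_gt0 n; lia. Qed.

Lemma level_queue_fits i : i <= n -> n + level_size i n < 2 ^ w.
Proof.
move=> ik; apply: leq_ltn_trans queues_fit; rewrite leq_add2l.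
by apply: leq_trans (level_size_fact ik); rewrite leq_pmull // fact_gt0.
Qed.

Lemma level_matches_fit i x : size x <= n -> level_matches k P i x < 2 ^ w.
Proof.
move=> xn; apply: leq_ltn_trans (matches_le_exp _ _) _.
by rewrite ltn_exp2l // (leq_ltn_trans xn n_lt_w).
Qed.

Let w_gt0 : 0 < w.
Proof. exact: leq_ltn_trans n_lt_w. Qed.

Section Scan.

Variables (t : nat) (g0 : nstate).
Hypothesis g0_pattern : forall a, a < K -> nmem g0 a = nth 0 P a.

Definition scan_env := [:: (r_one, 1); (r_zero, 0); (r_top, K); (r_mark, t)].

Definition scan_regs j :=
  [:: (r_scanning, nat_of_bool (j < K)); (r_rank, exceed_before t (take j P));
      (r_unseen, nat_of_bool (t \notin take j P)); (r_index, j)].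

Lemma scan_body_runs j g : j < K -> holds scan_env g ->
  holds (scan_regs j) g /\ same_memory g0 g ->
  runs w scan_body g 9 (fun g' => holds (scan_regs j.+1) g' /\ same_memory g0 g').
Proof.
move=> jK env_g [regs_g [memE tableE]].
have known : holds (scan_regs j ++ scan_env) g by rewrite holds_cat regs_g.
have jP : j < size P by rewrite (pattern_size P_perm); lia.
have takeE := take_nth 0 jP.
apply: runs_block; rewrite /= !(holdsE known) //= memE g0_pattern // !addn1.
  have := exceed_before_le t (take j.+1 P).
  rewrite takeE exceed_before_rcons -takeE size_takel // => rank_le.
  rewrite w_gt0 !mulnb !bool_fits //= andbT -mulnb; apply/andP; split.
    by apply: leq_ltn_trans rank_le _; have := n_succ2_fits; lia.
  by have := n_succ2_fits; lia.
by rewrite takeE exceed_before_rcons mem_rcons inE negb_or !mulnb eqb0 !eqxx.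
Qed.

Lemma scan_loop_runs g : holds scan_env g -> holds (scan_regs 0) g ->
  same_memory g0 g ->
  runs w (While r_scanning scan_body) g (10 * K).+1 (fun g' =>
    holds scan_env g' /\ (holds (scan_regs K) g' /\ same_memory g0 g')).
Proof.
move=> env_g regs0 same; apply: (@runs_while_frame _ _ _ _ (fun j g =>
  holds (scan_regs j) g /\ same_memory g0 g) (fun=> 9)) => //.
- by rewrite sum_nat_const card_ord; lia.
- by move=> j g' _ [known _]; rewrite (holdsE known) //=; case: ltnP.
by move=> j g' jK env_g'; apply: scan_body_runs.
Qed.

End Scan.

Definition tabulated i (table : nat -> nat -> option nat) :=
  {in shorter_words i (n - i).+1, forall x,
     table i (radix B x) = Some (level_matches k P i x)}.

Lemma level_matches_insert_table i m y l table : i <= K ->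
  (i < K -> tabulated i.+1 table) -> (forall j key, K < j -> table j key = None) ->
  marked_word i m y -> i + m < n -> l <= i + m ->
  level_matches k P i (insert_at l m.+1 y) = level_matches k P i y +
    (marks (take l y) == exceed_before (k - i) (take K P)) *
      odflt 0 (table i.+1 (radix B (insert_at l 0 y))).
Proof.
move=> iK solved none ym imn li; have sy := size_marked_word ym.
have -> : odflt 0 (table i.+1 (radix B (insert_at l 0 y))) =
    (i < K) * level_matches k P i.+1 (insert_at l 0 y).
  case: ltnP => [ik|Ki]; last by rewrite none.
  rewrite solved ?mul1n //; apply/mem_shorter_words; exists m; first by lia.
  exact: marked_word_insert_mark.
have [kn|nk] := leqP k n; last first.
  by rewrite !(level_matches_short P_perm) ?size_insert_at ?sy ?muln0 //; lia.
have KE : K = k by apply/minn_idPl.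
rewrite KE (@take_oversize _ k P) ?(pattern_size P_perm) //.
have [ik|ki] := ltnP i k; last first.
  have -> : i = k by lia.
  by rewrite mul0n muln0 addn0 level_matches_full_insert.
rewrite mul1n; apply: (level_matches_insert P_perm) => //; last exact: marks_marked_word ym.
by rewrite /= (marked_word_lt ym).
Qed.

Definition levels_env :=
  [:: (r_n, n); (r_k, k); (r_one, 1); (r_zero, 0); (r_bound, n.+1); (r_base, B);
      (r_top, K)].

Definition levels_solved d (g : nstate) :=
  [/\ forall a, a < K -> nmem g a = nth 0 P a,
      forall i, K < i + d -> i <= K -> tabulated i (ntable g) &
      forall j key, K < j -> ntable g j key = None].

Definition scan_start i :=
  [:: (r_level, i); (r_next_level, i.+1); (r_mark, k - i); (r_rank, 0);
      (r_index, 0); (r_unseen, 1); (r_scanning, nat_of_bool (0 < K))].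

Lemma start_scan_runs i g : i <= K ->
  holds ((r_next_level, i.+1) :: levels_env) g ->
  runs w start_scan g 6 (fun g' => holds (scan_start i) g' /\ same_memory g g').
Proof.
move=> iK known; have n_fits := n_succ2_fits.
have Kn := geq_minr k n; have Kk := geq_minl k n.
have one_fits : 1 < 2 ^ w by lia.
apply: runs_block; rewrite /= !(holdsE known) //= subn1 /= ?eqxx //.
rewrite one_fits expn_gt0 k_fits w_gt0 (leq_trans iK Kk).
by rewrite (leq_ltn_trans _ n_fits) //; lia.
Qed.

Lemma start_queue_runs i g : i <= K ->
  holds ([:: (r_level, i); (r_next_level, i.+1)] ++ levels_env) g ->
  runs w start_queue g 9 (fun g' => holds (length_regs n i 0) g' /\
    queue_holds n B i (level_matches k P i) (nmem g) (ntable g) [:: nseq i 0] g').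
Proof.
move=> iK known; have n_fits := n_succ2_fits.
have Kn := geq_minr k n; have Kk := geq_minl k n.
apply: runs_block; first by rewrite /= w_gt0 !andbT; lia.
rewrite /= !(holdsE known) //= !addn0 addn1 !eqxx; split=> //.
have nil : queue_holds n B i (level_matches k P i) (nmem g) (ntable g) [::] g by split.
apply: (queue_holds_rcons n_lt_base _ nil) => [||a|j key].
- exact: leq_trans Kn.
- by apply/mem_shorter_words; exists 0; rewrite // /marked_word cats0.
- by rewrite /= radix_nseq0 addn0.
by rewrite /= radix_nseq0 (level_matches_marks P_perm) //; lia.
Qed.

Lemma levels_solvedS d g g' : d <= K -> levels_solved d g ->
  queue_holds n B (K - d) (level_matches k P (K - d)) (nmem g) (ntable g)
    (shorter_words (K - d) (n - (K - d)).+1) g' ->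
  levels_solved d.+1 g'.
Proof.
move=> dK [pattern solved none] [_ memE _ values others]; split=> [a aK|i Ki iK|j key Kj].
- by rewrite memE ?pattern // (leq_trans aK) // geq_minr.
- have [->|ne] := eqVneq i (K - d); first exact: values.
  by move=> x xi; rewrite others // solved //; lia.
by rewrite others ?none //; lia.
Qed.

Lemma open_level_runs i g : i <= K ->
  holds ((r_next_level, i.+1) :: levels_env) g ->
  (forall a, a < K -> nmem g a = nth 0 P a) ->
  runs w open_level g (6 + ((10 * K).+1 + 9)) (fun g' =>
    holds (length_env n B i (exceed_before (k - i) (take K P))) g' /\
    (holds (length_regs n i 0) g' /\
     queue_holds n B i (level_matches k P i) (nmem g) (ntable g) [:: nseq i 0] g')).
Proof.
move=> iK known pattern.
apply: (runs_seq (runs_frame _ known (start_scan_runs iK known))) => //.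
move=> g1 [known1 [start1 same1]].
have {start1}known1 : holds (scan_start i ++ (r_next_level, i.+1) :: levels_env) g1.
  by rewrite holds_cat start1.
have regs1 : holds ([:: (r_level, i); (r_next_level, i.+1)] ++ levels_env) g1.
  by rewrite /= !(holdsE known1) //= !eqxx.
have scan := scan_loop_runs (t := k - i) pattern _ _ same1.
apply: (runs_seq (runs_frame _ regs1 (scan _ _))) => //.
- by rewrite /= !(holdsE known1) //= !eqxx.
- by rewrite /= !(holdsE known1) //= take0 !eqxx.
move=> g2 [known2 [_ [scan2 [<- <-]]]].
have rank2 : holds ((r_rank, exceed_before (k - i) (take K P)) ::
    [:: (r_level, i); (r_next_level, i.+1)] ++ levels_env) g2.
  by have /and3P[_ rankE _] := scan2; apply/andP.
apply: (runs_weaken (runs_frame _ rank2 (start_queue_runs iK known2))) => //.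
move=> g3 [known3 queue3]; split=> //.
by rewrite /= !(holdsE known3) //= !eqxx.
Qed.

Definition level_time d :=
  6 + ((10 * K).+1 + 9) + (80 * level_size (K - d) n + 1).

Lemma level_body_runs d g : d < K.+1 -> holds levels_env g ->
  holds [:: (r_next_level, K.+1 - d)] g /\ levels_solved d g ->
  runs w level_body g (level_time d) (fun g' =>
    holds [:: (r_next_level, K.+1 - d.+1)] g' /\ levels_solved d.+1 g').
Proof.
move=> dK env_g [regs_g solved_g]; have [pattern solved none] := solved_g.
set i := K - d; have iK : i <= K by apply: leq_subr.
have i_le_n : i <= n := leq_trans iK (geq_minr k n).
have known : holds ((r_next_level, i.+1) :: levels_env) g.
  by rewrite -cat1s holds_cat env_g andbT -subSn.
apply: (runs_seq (open_level_runs iK known pattern)) => g1 [known1 [regs1 queue1]].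
have insert_table m y l : marked_word i m y -> i + m < n -> l <= i + m ->
    level_matches k P i (insert_at l m.+1 y) = level_matches k P i y +
      (marks (take l y) == exceed_before (k - i) (take K P)) *
        odflt 0 (ntable g i.+1 (radix B (insert_at l 0 y))).
  apply: level_matches_insert_table => // iK'; apply: solved => //.
  by rewrite addSn subnK.
have loop := length_loop_runs n_lt_base i_le_n w_gt0 base_exp_fits
  (level_queue_fits i_le_n) (@level_matches_fit i) insert_table known1 regs1 queue1.
apply: (runs_seq loop) => g2 [known2 queue2].
apply: runs_block => //; rewrite /= !(holdsE known2) //= subSS eqxx; split=> //.
exact: levels_solvedS solved_g queue2.
Qed.

Lemma level_loop_time : \sum_(d < K.+1) (level_time d).+1 < 800 * n`!.
Proof.
have -> : \sum_(d < K.+1) (level_time d).+1 =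
    K.+1 * (10 * K + 18) + 80 * \sum_(i < K.+1) level_size i n.
  rewrite [in RHS](reindex_inj rev_ord_inj) big_distrr -[X in X * _ + _]card_ord.
  rewrite -sum_nat_const -big_split; apply: eq_bigr => d _.
  by rewrite /level_time /= subSS; lia.
have Kn := geq_minr k n; have := sum_level_size_le Kn; rewrite -/K.
have := sqr_le_fact n_gt1; have := fact_gt0 n.
move: (n`!) (\sum_(i < K.+1) _) => f s; rewrite -/K in Kn.
rewrite -mulnn; nia.
Qed.

Lemma level_loop_runs g : holds levels_env g -> holds [:: (r_next_level, K.+1)] g ->
  (forall a, a < K -> nmem g a = nth 0 P a) -> (forall j key, ntable g j key = None) ->
  runs w (While r_next_level level_body) g (800 * n`!) (fun g' => tabulated 0 (ntable g')).
Proof.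
move=> env_g regs0 pattern none.
apply: (@runs_weaken _ _ _ (800 * n`!) _ (fun g' => holds levels_env g' /\
    (holds [:: (r_next_level, K.+1 - K.+1)] g' /\ levels_solved K.+1 g'))) => //.
  apply: (@runs_while_frame _ _ _ _ (fun d g =>
    holds [:: (r_next_level, K.+1 - d)] g /\ levels_solved d g) level_time) => //.
  - exact: level_loop_time.
  - by move=> d g' _ [known _]; rewrite (holdsE known) //= -lt0n subn_gt0.
  - by move=> d g' dK env_g'; apply: level_body_runs.
  by split=> //; split=> // i; rewrite addn0; lia.
by move=> g' [_ [_ [_ solved _]]]; apply: solved; rewrite // addnS addn0.
Qed.

Definition base_env := [:: (r_n, n); (r_k, k); (r_one, 1); (r_zero, 0); (r_bound, n.+1)].

Definition base_regs j :=
  [:: (r_scratch, nat_of_bool (j < letter_bits n)); (r_base, 2 ^ j)].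

Lemma exp2_le_n j : (2 ^ j <= n) = (j < letter_bits n).
Proof.
rewrite ltnS; apply/idP/idP => [|jl]; first exact: trunc_log_max.
by apply: leq_trans (trunc_logP (ltnSn 1) (ltnW n_gt1)); rewrite leq_exp2l.
Qed.

Lemma letter_bits_le_n : letter_bits n <= n.
Proof.
exact: leq_trans (ltn_expl _ (ltnSn 1)) (trunc_logP (ltnSn 1) (ltnW n_gt1)).
Qed.

Lemma base_loop_runs g : holds base_env g -> holds (base_regs 0) g ->
  runs w (While r_scratch double_base) g (3 * letter_bits n).+1 (fun g' =>
    holds base_env g' /\ (holds (base_regs (letter_bits n)) g' /\
      same_memory g g')).
Proof.
move=> env_g regs0; apply: (@runs_while_frame _ _ _ _ (fun j g' =>
  holds (base_regs j) g' /\ same_memory g g') (fun=> 2)) => //.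
- by rewrite sum_nat_const card_ord; lia.
- by move=> j g' _ [known _]; rewrite (holdsE known) //=; case: ltnP.
move=> j g' jl env_g' [regs_g frame].
have known : holds (base_regs j ++ base_env) g' by rewrite holds_cat regs_g.
apply: runs_block; rewrite /= !(holdsE known) //= addnn -mul2n -expnS.
  have j_lt_w := leq_ltn_trans (leq_trans jl letter_bits_le_n) n_lt_w.
  by rewrite w_gt0 ltn_exp2l // j_lt_w.
by rewrite ltnS exp2_le_n !eqxx.
Qed.

Lemma start_levels_runs g : holds ((r_base, B) :: base_env) g ->
  runs w start_levels g (2 + (2 + 1)) (fun g' =>
    holds ((r_next_level, K.+1) :: levels_env) g' /\
    same_memory g g').
Proof.
move=> known; have n_fits := n_succ2_fits; have Kn := geq_minr k n.
apply: (runs_seq (Q1 := fun g1 => holds ([:: (r_top, n); (r_scratch, nat_of_bool (k <= n));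
  (r_base, B)] ++ base_env) g1 /\ same_memory g g1)).
  by apply: runs_block; rewrite /= ?w_gt0 // !(holdsE known) //= ltnS !eqxx.
move=> g1 [known1 frame1].
apply: (runs_seq (Q1 := fun g2 => holds ([:: (r_top, K); (r_base, B)] ++ base_env) g2 /\
  same_memory g g2)).
  apply: runs_if; rewrite (holdsE known1) //=; case: (leqP k n) => kn /=.
    by apply: runs_block => //; rewrite /= !(holdsE known1) //= /K (minn_idPl kn) !eqxx.
  by apply: runs_skip; rewrite /= !(holdsE known1) //= /K (minn_idPr (ltnW kn)) !eqxx.
move=> g2 [known2 frame2]; apply: runs_block; rewrite /= !(holdsE known2) //= addn1.
  by rewrite andbT -/K; lia.
by rewrite !eqxx.
Qed.

Lemma count_hits_long_runs g : holds [:: (r_n, n); (r_k, k); (r_one, 1); (r_zero, 0)] g ->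
  nmem g =1 nth 0 P -> (forall j key, ntable g j key = None) ->
  runs w count_hits_long g (810 * n`!) (fun g' => tabulated 0 (ntable g')).
Proof.
move=> known memE none; have n_fits := n_succ2_fits; have one_fits : 1 < 2 ^ w by lia.
apply: (@runs_weaken _ _ _ (3 + ((3 * letter_bits n).+1 + (5 + 800 * n`!))) _
  (fun g' => tabulated 0 (ntable g'))) => //; last first.
  by have := letter_bits_le_n; have := fact_geq n; lia.
apply: (runs_seq (Q1 := fun g1 => holds base_env g1 /\ (holds (base_regs 0) g1 /\
  same_memory g g1))).
  apply: runs_block; rewrite /= !(holdsE known) //= addn1.
    by rewrite w_gt0 one_fits (leq_ltn_trans _ n_fits) //; lia.
  by rewrite (ltnW n_gt1 : 1 < n.+1) !eqxx.
move=> g1 [known1 [regs1 [mem1 table1]]].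
apply: (runs_seq (base_loop_runs known1 regs1)) => g2 [known2 [regs2 [mem2 table2]]].
have base2 : holds ((r_base, B) :: base_env) g2.
  by have /and3P[_ baseE _] := regs2; apply/andP.
apply: (runs_seq (start_levels_runs base2)) => g3 [known3 [mem3 table3]].
have [next3 env3] := andP known3.
apply: level_loop_runs => // [|a _|j key]; first by apply/andP.
  by rewrite mem3 mem2 mem1 memE.
by rewrite table3 table2 table1 none.
Qed.

End AllLevels.

Lemma perm_word_marked n (t : 'S_n) : marked_word 0 n (perm_word t).
Proof. exact: perm_word_iota. Qed.

Definition input_nstate n k (p : 'S_k) : nstate :=
  NState (fun r => match r with 0 => n | 1 => k | _ => 0 end)
    (nth 0 (perm_word p)) (fun _ _ => None).

Definition counts_hits n k (p : 'S_k) (g : nstate) :=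
  forall t : 'S_n,
    ntable g 0 (radix (2 ^ letter_bits n) (perm_word t)) = Some #|hits p t|.

Lemma perm_word_small n (t : 'S_n) : n <= 1 -> perm_word t = iota 1 n.
Proof.
by case: n t => [|[|//]] t _; apply: perm_small_eq (perm_word_iota t).
Qed.

Lemma card_hits_small n k (p : 'S_k) (t : 'S_n) : n <= 1 -> #|hits p t| = (k <= n).
Proof.
rewrite card_hits => n1; case: (leqP k n) => kn; last first.
  rewrite (level_matches_short (perm_word_iota p)) //.
  by rewrite (pattern_size (perm_word_iota t)).
rewrite !perm_word_small //; last exact: leq_trans n1.
rewrite /level_matches /matches (eq_count (fun u => order_iso_zip _ (0 :: u))).
by case: n kn n1 {t} => [|[|//]]; case: k {p} => [|[|//]].
Qed.

Lemma count_hits_short_runs w n k (p : 'S_k) g : 0 < w -> n <= 1 ->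
  holds [:: (r_n, n); (r_k, k); (r_zero, 0)] g ->
  runs w count_hits_short g 3 (counts_hits n p).
Proof.
move=> w0 n1 known; apply: runs_block; first by rewrite /= w0.
rewrite /= !(holdsE known) //= => t.
rewrite card_hits_small // perm_word_small //= eqb0 -leqNgt.
by case: n n1 {known t} => [|[|//]] _ /=; rewrite ?eqxx.
Qed.

Lemma count_hits_runs w n k (p : 'S_k) :
  0 < w -> n * letter_bits n <= w -> k < 2 ^ w ->
  runs w count_hits (input_nstate n p) (900 * n`!) (counts_hits n p).
Proof.
move=> w0 w_large k_fits; have one_fits := bool_fits true w0.
apply: (@runs_weaken _ _ _ (2 + (810 * n`!).+1) _ (counts_hits n p)) => //; last first.
  by have := fact_gt0 n; lia.
apply: (runs_seq (Q1 := fun g1 =>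
  holds [:: (r_scratch, nat_of_bool (1 < n)); (r_n, n); (r_k, k); (r_one, 1);
    (r_zero, 0)] g1 /\
  (nmem g1 = nth 0 (perm_word p) /\ ntable g1 = fun _ _ => None))).
  by apply: runs_block; rewrite /= ?one_fits ?w0 ?eqxx.
move=> g1 [known1 [mem1 table1]]; apply: runs_if; rewrite (holdsE known1) //=.
case: (ltnP 1 n) => n1 /=; last first.
  apply: (runs_weaken (@count_hits_short_runs w n k p g1 w0 n1 _)) => //.
    by rewrite /= !(holdsE known1) //= !eqxx.
  by have := fact_gt0 n; lia.
have long := count_hits_long_runs (perm_word_iota p) n1 w_large k_fits.
apply: (runs_weaken (long _ _ _ _)) => //.
- by rewrite /= !(holdsE known1) //= !eqxx.
- by move=> a; rewrite mem1.
- by move=> j key; rewrite table1.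
move=> g2 solved t; rewrite card_hits; apply: solved.
by apply/mem_shorter_words; exists n; [rewrite subn0|exact: perm_word_marked].
Qed.

(** * Correctness and running time *)

Lemma represents_init n k (p : 'S_k) : represents (init_state n p) (input_nstate n p).
Proof.
split=> [[|[|r]]|a|//] //; rewrite /= Nnat.Nat2N.id.
case: (ltnP a (size (perm_word p))) => ap; first by rewrite (nth_map 0).
by rewrite [LHS]nth_default ?(size_map N.of_nat) // nth_default.
Qed.

Lemma pack_perm_inj n : injective (@pack_perm n).
Proof.
move=> s t; rewrite /pack_perm !pack_radix => /Nnat.Nat2N.inj st.
have lt_base (u : 'S_n) : all (gtn (2 ^ letter_bits n)) (perm_word u).
  exact: marked_word_lt (perm_word_marked u) (trunc_log_ltn _ _).
apply/perm_word_inj/(radix_inj _ _ _ st); rewrite ?lt_base //.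
by rewrite !marks_eq0 ?perm_word_gt0.
Qed.

Lemma outputs_hits_time w c n k (p : 'S_k) T s :
  exec w unit_cost c (init_state n p) T s -> outputs_hits n p s -> n`! <= T.
Proof.
move=> e out; pose keys := [seq pack_perm t | t : 'S_n].
have keys_uniq : uniq keys by rewrite map_inj_uniq ?enum_uniq //; apply: pack_perm_inj.
have := count_keys_le_time N0 keys_uniq e; rewrite count_pred0 add0n.
rewrite (eq_in_count (a2 := predT)) ?count_predT ?size_image ?card_Sn //.
by move=> key /mapP[t _ ->]; rewrite out.
Qed.

Lemma count_hits_correct w n k (p : 'S_k) :
  0 < w -> n * letter_bits n <= w -> k < 2 ^ w ->
  exists T s, [/\ exec w unit_cost count_hits (init_state n p) T s,
    n`! <= T <= 900 * n`! & outputs_hits n p s].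
Proof.
move=> w0 w_large k_fits.
have := count_hits_runs w0 w_large k_fits (represents_init n p).
case=> T [s [e T_le [g [_ _ tableE] counts]]].
have out : outputs_hits n p s.
  by move=> t; rewrite /pack_perm pack_radix (tableE 0) counts.
by exists T, s; split=> //; rewrite T_le (outputs_hits_time e out).
Qed.

Theorem theorem5p5 :
  exists prog : cmd,
  forall cost : opcode -> nat, (forall o : opcode, 0 < cost o) ->
  exists c1 c2 : nat,
    [/\ 0 < c1, 0 < c2 &
      forall (k : nat) (p : 'S_k) (n w : nat),
        0 < w -> n * letter_bits n <= w -> k < 2 ^ w ->
        exists (T : nat) (s : state),
          [/\ exec w cost prog (init_state n p) T s,
              c1 * n`! <= T <= c2 * n`! &
              outputs_hits n p s]].
Proof.
exists count_hits => cost cost_gt0; set M := sumn (map cost opcodes).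
have cost_bounds o : 0 < cost o <= M by rewrite cost_gt0 cost_le_sum.
have M_gt0 : 0 < M by have /andP[/leq_trans] := cost_bounds KTest; apply.
exists 1, (M * 900); split=> // [|k p n w w_gt0 w_large k_fits].
  by rewrite muln_gt0 M_gt0.
have [T [s [unit_run /andP[T_ge T_le] out]]] := count_hits_correct p w_gt0 w_large k_fits.
have [T' run /andP[T'_ge T'_le]] := exec_unit_cost cost_bounds unit_run.
exists T', s; split=> //; rewrite mul1n (leq_trans T_ge T'_ge) (leq_trans T'_le) //.
by rewrite -mulnA leq_mul2l T_le orbT.
Qed.
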